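(* For any bounded continuous function $\varphi:C[0,1]\to\mathbb{C}$ we have, as $p\to\infty$ through the primes, $$\lim_{p\to\infty}\frac1p\sum_{k=0}^{p-1}\varphi\big(G_p(k,\cdot)\big)=\mathbb{E}\,\varphi(G_{\mathbb{X}}),$$ where $G_p(k,\cdot)\in C[0,1]$ is the function $t\mapsto F_p\left(e\left(\frac{k+t}{p}\right)\right)/F_p(\zeta_p)$.
   Context: Write $e(t):=e^{2\pi i t}$ and $\zeta_p:=e(1/p)$. $C[0,1]$ is the space of continuous complex-valued functions on $[0,1]$ with the supremum norm. For an odd prime $p$, the Fekete polynomial is $F_p(z):=\sum_{n=1}^{p-1}\left(\frac{n}{p}\right)z^n$, where $\left(\frac{\cdot}{p}\right)$ is the Legendre symbol modulo $p$. Let $\{\mathbb{X}(m)\}_{m\in\mathbb{Z}}$ be independent identically distributed random variables taking the values $\pm1$ with probability $1/2$ each. The random process $G_{\mathbb{X}}$ on $C[0,1]$ is $$G_{\mathbb{X}}(t):=\sum_{m\in\mathbb{Z}}\frac{e(t)-1}{2\pi i(m-t)}\,\mathbb{X}(m),\qquad t\in[0,1],$$ where the series is the (almost surely existing) limit of the sums over $|m|\le M$ as $M\to\infty$, and the coefficients at $(m,t)=(0,0)$ and $(1,1)$ are interpreted by continuity (their value is $-1$). *)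

(* Defs.v *)
From HB Require Import structures.
From mathcomp Require Import all_boot all_order all_algebra.
From mathcomp Require Import all_classical all_reals all_analysis.
From mathcomp Require Import complex.

Set Implicit Arguments.
Unset Strict Implicit.
Unset Printing Implicit Defensive.

Import Order.TTheory GRing.Theory Num.Theory.
Import numFieldNormedType.Exports.
Local Open Scope classical_set_scope.
Local Open Scope ring_scope.
Local Open Scope complex_scope.

(* R[i] carries the topology of its modulus, as a normed space over itself. *)
HB.instance Definition _ (R : rcfType) :=
  NormedModule.copy R[i] ((R[i] : numFieldType) : Type).

Notation cabs := ComplexField.Normc.normc.

Section ComplexTopology.
Variable R : realType.

Lemma ball_complexE (z w : R[i]) (eps : R) :
  ball z eps%:C w <-> cabs (z - w) < eps.
Proof. by rewrite -ball_normE /ball_ /= -ltcR. Qed.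

Lemma complex_gt0 (eps : R[i]) : 0 < eps -> 0 < complex.Re eps /\ eps = (complex.Re eps)%:C.
Proof.
move=> e0; have ee := RRe_real (gtr0_real e0); split=> //.
by rewrite -ltcR ee.
Qed.

Lemma nbhs_complexP (z : R[i]) (A : set R[i]) :
  nbhs z A <-> exists2 eps : R, 0 < eps & forall w, cabs (z - w) < eps -> A w.
Proof.
split=> [/nbhs_ballP[/= eps e0 H]|[eps e0 H]].
  have [e0' ee] := complex_gt0 e0; exists (complex.Re eps) => // w.
  by rewrite -ball_complexE -ee; exact: H.
apply/nbhs_ballP; exists eps%:C => /=; first by rewrite ltcR.
by move=> w /ball_complexE; exact: H.
Qed.

Lemma cabs_dist (z w : R[i]) : `|cabs z - cabs w| <= cabs (z - w).
Proof.
have := ler_dist_dist z w.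
rewrite -[`|z|]/((cabs z)%:C) -[`|w|]/((cabs w)%:C) -[`|z - w|]/((cabs (z - w))%:C).
by rewrite -rmorphB /= normc_def /= expr0n /= addr0 sqrtr_sqr lecR.
Qed.

Lemma continuous_cabs : continuous (fun z : R[i] => cabs z).
Proof.
move=> z A /nbhs_ballP[/= eps e0 H]; apply/nbhs_complexP; exists eps => // w zw.
by apply: H; rewrite -ball_normE /ball_ /=; exact: le_lt_trans (cabs_dist _ _) zw.
Qed.

Lemma continuous_real_complex : continuous (fun x : R => x%:C).
Proof.
move=> x A /nbhs_complexP[eps e0 H].
apply/nbhs_ballP; exists eps => //= y; rewrite -ball_normE /ball_ /= => xy; apply: H.
by rewrite -rmorphB /= expr0n /= addr0 sqrtr_sqr.
Qed.

End ComplexTopology.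

Definition I01 (R : realType) : Type := set_type (`[0, 1]%classic : set R).
HB.instance Definition _ (R : realType) := Topological.on (I01 R).

(* The topology is that of uniform convergence, which is the topology of the
   supremum norm: see nbhs_C01P. *)
Definition C01 (R : realType) : Type :=
  initial_topology (fun f : continuousType (I01 R) R[i] =>
    (f : I01 R -> R[i]) : {uniform I01 R -> R[i]}).
HB.instance Definition _ (R : realType) := Uniform.on (C01 R).

Definition C01_fun (R : realType) (f : C01 R) : I01 R -> R[i] :=
  (f : continuousType (I01 R) R[i]).
Coercion C01_fun : C01 >-> Funclass.

Definition mkC01 (R : realType) (f : I01 R -> R[i]) (cf : continuous f) : C01 R :=
  (mkcts cf : continuousType (I01 R) R[i]).

Definition supnorm (R : realType) (f : I01 R -> R[i]) : R :=
  sup [set cabs (f t) | t in [set: I01 R]].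

Section SupremumNorm.
Variable R : realType.
Implicit Types f g : C01 R.

Lemma continuous_C01 f : continuous (C01_fun f).
Proof. exact: (@cts_fun _ _ (f : continuousType (I01 R) R[i])). Qed.

Lemma cabs_le_supnorm (h : I01 R -> R[i]) (t : I01 R) :
  continuous h -> cabs (h t) <= supnorm h.
Proof.
move=> ch; apply: ub_le_sup; last by exists t.
have cn : continuous (fun s => cabs (h s)).
  by move=> s; apply: continuous_comp; [exact: ch|exact: continuous_cabs].
have := @subspace_valL_continuousP R (`[0, 1]%classic : set R) R (fun s : I01 R => cabs (h s)).
case=> _ /(_ cn) => cL.
have [c _ cmax] := EVT_max ler01 cL.
exists (valL (fun s : I01 R => cabs (h s)) c) => _ [s _ <-].
have := cmax (val s) (set_mem (valP s)).
by rewrite -[X in X <= _ -> _]/(sigL _ (valL (fun s : I01 R => cabs (h s))) s) valLK.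
Qed.

Lemma nbhs_C01P f (A : set (C01 R)) :
  nbhs f A <-> exists2 eps : R, 0 < eps &
    forall g, supnorm (fun t => f t - g t) < eps -> A g.
Proof.
have t0 : I01 R by exists 0; rewrite inE /= in_itv /= lexx ler01.
rewrite -nbhs_entourageE; split.
  case=> E [B + BE] EA; rewrite uniform_entourage => -[V + VB].
  rewrite -entourage_ballE => -[/= eps e0 epsV].
  have [e0' ee] := complex_gt0 e0; exists (complex.Re eps) => // g fg.
  apply/EA/xsectionP/BE => /=; apply: VB => t _ /=; apply: epsV => /=.
  rewrite ee; apply/ball_complexE; apply: le_lt_trans fg.
  apply: (@cabs_le_supnorm (fun t => f t - g t)).
  by move=> s; apply: continuousB; exact: continuous_C01.
case=> eps e0 H; have e20 : 0 < eps / 2 by rewrite divr_gt0.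
pose V := [set zw : R[i] * R[i] | ball zw.1 (eps / 2)%:C zw.2].
pose B := [set fg : {uniform I01 R -> R[i]} * {uniform I01 R -> R[i]} |
  forall t, V (fg.1 t, fg.2 t)].
exists [set fg : C01 R * C01 R | forall t, V (fg.1 t, fg.2 t)].
  exists B => //; rewrite uniform_entourage; exists V => [|fg /= fgV t].
    by rewrite -entourage_ballE; exists (eps / 2)%:C => //=; rewrite ltcR.
  exact: fgV.
move=> g /xsectionP /= fg; apply: H; apply: (@le_lt_trans _ _ (eps / 2)).
  apply: ge_sup; first by exists (cabs (f t0 - g t0)); exists t0.
  by move=> _ [t _ <-]; apply/ltW/ball_complexE; exact: fg.
by rewrite ltr_pdivrMr // mulr_natr mulr2n ltrDl.
Qed.

End SupremumNorm.

Section Fekete.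
Variable R : realType.

Definition e (t : R) : R[i] := cos (2 * pi * t) +i* sin (2 * pi * t).

(* The Legendre symbol (n/p) when p is an odd prime *)
Definition legendre (p n : nat) : int :=
  if (p %| n)%N then 0
  else if [exists x : 'I_p, (x ^ 2 == n %[mod p])%N] then 1 else - 1.

Definition fekete (p : nat) : {poly R[i]} :=
  \sum_(1 <= n < p) (legendre p n)%:~R *: 'X^n.

Definition Gp_fun (p k : nat) (t : I01 R) : R[i] :=
  (fekete p).[e ((k%:R + val t) / p%:R)] / (fekete p).[e (p%:R^-1)].

Lemma continuous_e : continuous e.
Proof.
have -> : e = (fun t => (cos (2 * pi * t))%:C + 'i * (sin (2 * pi * t))%:C).
  by apply/funext => t; rewrite /e; simpc.
have c2 : continuous (fun t : R => 2 * pi * t) by exact: mulrl_continuous.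
have cC (f : R -> R) : continuous f -> continuous (fun t => (f t)%:C).
  by move=> cf t; apply: continuous_comp; [exact: cf|exact: continuous_real_complex].
have cc : continuous (fun t : R => (cos (2 * pi * t))%:C).
  by apply: cC => s; apply: continuous_comp; [exact: c2|exact: continuous_cos].
have cs : continuous (fun t : R => (sin (2 * pi * t))%:C).
  by apply: cC => s; apply: continuous_comp; [exact: c2|exact: continuous_sin].
move=> t.
exact: (continuousD (cc t) (continuousM (@cst_continuous R R[i] 'i t) (cs t))).
Qed.

Lemma continuous_horner_complex (q : {poly R[i]}) :
  continuous (fun z : R[i] => q.[z]).
Proof.
elim/poly_ind: q => [|q c IH] z.
  have -> : (fun w : R[i] => (0 : {poly R[i]}).[w]) = fun=> 0.
    by apply/funext => w; rewrite horner0.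
  exact: (@cst_continuous R[i] R[i] 0 z).
have -> : (fun w : R[i] => (q * 'X + c%:P).[w]) = fun w => q.[w] * w + c.
  by apply/funext => w; rewrite hornerMXaddC.
have cid : {for z, continuous (fun w : R[i] => w)} by [].
exact: (continuousD (continuousM (IH z) cid) (@cst_continuous R[i] R[i] c z)).
Qed.

Lemma continuous_Gp (p k : nat) : continuous (Gp_fun p k).
Proof.
move=> t; rewrite /Gp_fun.
have ca : continuous (fun s : I01 R => (k%:R + val s) / p%:R : R).
  move=> s; apply: (@continuousM R (I01 R)); last exact: cst_continuous.
  apply: (@continuousD R R (I01 R)); first exact: cst_continuous.
  exact: initial_continuous.
have ch : continuous (fun s : I01 R => (fekete p).[e ((k%:R + val s) / p%:R)]).
  move=> s; apply: (@continuous_comp (I01 R) R[i] R[i]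
    (fun s => e ((k%:R + val s) / p%:R)) (horner (fekete p))).
    by apply: continuous_comp; [exact: ca|exact: continuous_e].
  exact: continuous_horner_complex.
exact: (continuousM (ch t)
  (@cst_continuous (I01 R) R[i] (fekete p).[e (p%:R^-1)]^-1 t)).
Qed.

Definition Gp (p k : nat) : C01 R := mkC01 (@continuous_Gp p k).

End Fekete.
Arguments Gp R p k : clear implicits.

Section SignSeries.
Variable R : realType.

(* The coefficient (e(t) - 1) / (2 pi i (m - t)). On [0,1], t = m happens only
   at (m, t) = (0, 0) and (1, 1), where the value by continuity is -1. *)
Definition GX_coef (m : int) (t : R) : R[i] :=
  if t == m%:~R then -1
  else (e t - 1) / (0 +i* (2 * pi * (m%:~R - t))).

(* The sum over |m| <= M, with m = j - M for 0 <= j <= 2M *)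
Definition GX_partial (x : int -> R) (M : nat) (t : I01 R) : R[i] :=
  \sum_(j < M.*2.+1)
    GX_coef (j%:Z - M%:Z) (val t) * (x (j%:Z - M%:Z))%:C.

(* The series converges for every t in [0,1], to a function continuous in t, for
   almost every realization x of independent uniform signs. The values of lim on
   a divergent sequence, and of toC01 on a discontinuous function, are junk used
   only on the exceptional null set. *)
Definition toC01 (f : I01 R -> R[i]) : C01 R :=
  match pselect (continuous f) with
  | left cf => mkC01 cf
  | right _ => (cst (0 : R[i]) : continuousType (I01 R) R[i])
  end.

Definition GX (x : int -> R) : C01 R :=
  toC01 (fun t => lim (GX_partial x M t @[M --> \oo])).

End SignSeries.

Section Probability.
Variables (R : realType) (d : measure_display) (T : measurableType d).
Variable P : probability T R.

Definition mutually_independent (I : eqType) (X : I -> {RV P >-> R}) : Prop :=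
  forall (s : seq I) (A : I -> set R), uniq s -> (forall i, measurable (A i)) ->
  P (\bigcap_(i in [set` s]) (X i @^-1` A i))
    = (\prod_(i <- s) P (X i @^-1` A i))%E.

Definition iid_signs (X : int -> {RV P >-> R}) : Prop :=
  mutually_independent X /\
  forall m, P [set w | X m w = 1] = (2^-1)%:E /\
            P [set w | X m w = -1] = (2^-1)%:E.

Definition expectationC (Y : T -> R[i]) : R[i] :=
  fine 'E_P[fun w => complex.Re (Y w)] +i* fine 'E_P[fun w => complex.Im (Y w)].

End Probability.
Arguments mutually_independent {R d T} P {I} X.
Arguments iid_signs {R d T} P X.

(* Main.v *)
Require Import Defs.
From mathcomp Require Import all_boot all_order all_algebra.
From mathcomp Require Import all_fingroup all_solvable all_field.
From mathcomp Require Import all_classical all_reals all_analysis.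
From mathcomp Require Import complex measurable_realfun.
From mathcomp Require Import zify ring lra.

Set Implicit Arguments.
Unset Strict Implicit.
Unset Printing Implicit Defensive.

Import Order.TTheory GRing.Theory Num.Theory.
Import numFieldNormedType.Exports.
Import ComplexField.Normc.
Local Open Scope ring_scope.

(* By Lagrange interpolation of F_p at the p-th roots of unity, G_p(k, t) is a
   sum over residues m of the Legendre symbols ((k + m) / p) against a Dirichlet
   kernel D_p(t - m), which tends to -(e(t) - 1) / (2 pi i (m - t)) as p tends to
   infinity; the sign is absorbed by the symmetry of X.

   For fixed M the symbols ((k + m) / p), |m| <= M, become equidistributed among
   sign patterns: the correlation sums are o(p). Since no power saving is
   needed, Stepanov's polynomial method with a fixed order of vanishing suffices.

   No chaining is needed for the tails |m| > M: up to an error O(1 / m^2) uniform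
   in t, the coefficients factor as (e(t) - 1) c_m with c_m = O(1 / m), so the
   supremum over t is controlled by the single sum of c_m ((k + m) / p), whose
   second moment is explicit. The same reduction gives the almost sure uniform
   convergence of the series defining G_X.

   This yields the limit for Lipschitz phi. A bounded continuous phi is the
   increasing limit of the Lipschitz functions inf_g (phi g + n |f - g|), which
   gives the lower bound for the liminf; apply it to phi and to -phi. *)

(** * Stepanov's method for products of linear factors *)

(** Truncating the interpolation formula costs an error that is uniform in t but small only on
    average over k. A Lipschitz functional passes such an averaged bound on to its own values, which
    a merely continuous one does not; this is why Lipschitz functionals take the place of a
    tightness argument.

    Stepanov's method yields only upper bounds p/2 + O(p/L), for a fixed order of vanishing 2L, on
    the number of x with f(x)^((p-1)/2) equal to 1, and likewise to -1. The two counts add up to at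
    least p minus the number of roots of f, so each upper bound is also a lower bound for the other
    count.

    The second moment of the tails is explicit because two distinct shifts of the quadratic
    character have correlation sum exactly -1.

    Measurability of phi(G_X) is a result of the limit process: on a set of full measure it is a
    pointwise limit of functions of finitely many signs, and off that set only boundedness
    enters. *)

Lemma dvdn_fact_prime (p n : nat) : prime p -> (p %| n`!)%N -> (p <= n)%N.
Proof.
move=> pr; elim: n => [|n IH]; first by rewrite fact0 dvdn1 => /eqP p1; rewrite p1 in pr.
rewrite factS Euclid_dvdM // => /orP[/dvdn_leq->//|/IH/leq_trans->//].
Qed.

(** The Taylor coefficients at x are Hasse derivatives, and k! times the k-th one is the ordinary
    derivative. As k! is invertible for k < p, ordinary derivatives detect multiplicities up to
    p. *)
Lemma dvdp_derivn_root (F : fieldType) (p l : nat) (P : {poly F}) (x : F) :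
  p \in [pchar F] -> (l <= p)%N -> (forall k, (k < l)%N -> root P^`(k) x) ->
  ('X - x%:P) ^+ l %| P.
Proof.
move=> charF lp rP; have [p_pr _] := andP charF.
have PE : P = \sum_(i < size P) (P^`N(i).[x])%:P * ('X - x%:P) ^+ i.
  have /nderiv_taylor : GRing.comm (x%:P : {poly F}) ('X - x%:P) by exact: mulrC.
  move=> /(_ (map_poly polyC P)); rewrite addrC subrK -/(comp_poly _ _) comp_polyXr.
  rewrite size_map_polyC => {1}->; apply: eq_bigr => i _.
  by rewrite nderivn_map horner_map.
rewrite PE; apply: (big_ind (fun Q => _ %| Q)) => [|Q1 Q2|i _]; first exact: dvdp0.
  exact: dvdp_add.
case: (ltnP i l) => il; last by rewrite -(subnKC il) exprD mulrCA dvdp_mulr.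
have := rP _ il; rewrite nderivn_def /root hornerMn -mulr_natr mulf_eq0.
rewrite -(dvdn_pcharf charF) => /orP[/eqP->|/(dvdn_fact_prime p_pr)].
  by rewrite mul0r dvdp0.
by rewrite leqNgt (leq_trans il lp).
Qed.

Lemma size_gt_multiple_roots (F : fieldType) (l : nat) (P : {poly F}) (s : seq F) :
  P != 0 -> uniq s -> (forall x, x \in s -> ('X - x%:P) ^+ l %| P) ->
  (size s * l < size P)%N.
Proof.
move=> P0 us ds; have /dvdp_leq-/(_ P0) : (\prod_(x <- s) ('X - x%:P)) ^+ l %| P.
  elim: s us ds => [|x s IH] /=; first by rewrite big_nil expr1n dvd1p.
  move=> /andP[xs us] ds; rewrite big_cons exprMn Gauss_dvdp.
    rewrite ds ?mem_head // IH // => y ys; apply: ds; by rewrite in_cons ys orbT.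
  apply/coprimep_expl/coprimep_expr; rewrite coprimep_sym coprimep_XsubC.
  by rewrite root_prod_XsubC.
apply: leq_trans; rewrite -[X in (_ < X)%N]prednK.
  by rewrite size_exp size_prod_XsubC.
by rewrite size_poly_gt0 expf_neq0 // monic_neq0 // monic_prod_XsubC.
Qed.

Lemma deriv_expM (R : comNzRingType) (q S : {poly R}) (e : nat) :
  (q ^+ e.+1 * S)^`() = q ^+ e * (e.+1%:R * (q^`() * S) + q * S^`()).
Proof.
rewrite derivM deriv_exp exprSr -mulr_natl /=; ring.
Qed.

(** * The auxiliary polynomial: sums of (a_i + b_i f^h) X^(ip) with h = (p - 1)/2 *)

Section Stepanov.
Variables (F : finFieldType) (p : nat).
Hypotheses (p_pr : prime p) (p_odd : odd p) (cardF : #|F| = p).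
Variables (rs : seq F).
Hypotheses (urs : uniq rs) (rs0 : 0 \notin rs) (rsN : (0 < size rs)%N).

Let f : {poly F} := \prod_(r <- rs) ('X - r%:P).
Let d := size rs.
Let h := p./2.

Let charF : p \in [pchar F].
Proof. by apply: (@card_finPcharP _ p 1); rewrite ?expn1. Qed.

Let size_f : size f = d.+1. Proof. exact: size_prod_XsubC. Qed.

Let f_neq0 : f != 0. Proof. by rewrite -size_poly_gt0 size_f. Qed.

Let pE : p = (h.*2).+1. Proof. by rewrite -[LHS]odd_double_half p_odd. Qed.

(** By the Frobenius identity the difference is the p-th power of q - q(0), which X divides. *)
Lemma dvdpXp_expp (q : {poly F}) : 'X^p %| q ^+ p - ((q.[0]) ^+ p)%:P.
Proof.
have charP : [pchar {poly F}].-nat p.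
  by rewrite (eq_pnat _ (pchar_poly F)) (eq_pnat _ (pcharf_eq charF)) pnat_id.
have -> : q ^+ p - ((q.[0]) ^+ p)%:P = (q - (q.[0])%:P) ^+ p.
  apply/eqP; rewrite subr_eq polyC_exp -exprDn_pchar // subrK //.
by apply: dvdp_exp2r; rewrite -['X]subr0 dvdp_XsubCl /root hornerD hornerN hornerC subrr.
Qed.

(* A relation modulo X^p forces a^2 f = f(0) b^2, which is impossible since the
   roots of f are simple. *)
Lemma dvdpXp_lin_eq0 (a b : {poly F}) :
  ((size a).*2 + d <= p.+1)%N -> ((size b).*2 <= p.+1)%N ->
  'X^p %| a + b * f ^+ h -> a = 0 /\ b = 0.
Proof.
move=> sa sb ab.
set c := f.[0].
have c0 : c != 0.
  by rewrite /c -/(root f 0) root_prod_XsubC.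
(* Multiplying by the conjugate [a - b * f ^+ h] and by [f] turns f^(2h+1) into f^p, a constant
   modulo X^p; the size bounds then make the congruence an equality. *)
have E : a ^+ 2 * f - b ^+ 2 * (c ^+ p)%:P =
   (a + b * f ^+ h) * (a - b * f ^+ h) * f + b ^+ 2 * (f ^+ p - (c ^+ p)%:P).
  have -> : f ^+ p = f * f ^+ h * f ^+ h by rewrite -mulrA -exprD -exprS addnn -pE.
  by move: (f ^+ h) (c ^+ p)%:P => u v; ring.
have : 'X^p %| a ^+ 2 * f - b ^+ 2 * (c ^+ p)%:P.
  by rewrite E dvdp_add //; [rewrite -mulrA dvdp_mulr | rewrite dvdp_mull // dvdpXp_expp].
have sz : (size (a ^+ 2 * f - b ^+ 2 * (c ^+ p)%:P)%R <= p)%N.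
  rewrite (leq_trans (size_polyD _ _)) // size_polyN geq_max; apply/andP; split.
    case: (eqVneq a 0) => [->|a0]; first by rewrite expr0n mul0r size_poly0.
    apply: leq_trans (size_polyMleq _ _) _; rewrite size_f.
    move: a0; rewrite -size_poly_gt0; have := size_polyMleq a a; rewrite -expr2; lia.
  apply: leq_trans (size_polyMleq _ _) _; rewrite size_polyC expf_neq0 // addn1 /=.
  case: (eqVneq b 0) => [->|]; first by rewrite expr0n size_poly0.
  move: (sb); rewrite -size_poly_gt0 => sb' b0.
  by apply: leq_trans (size_polyMleq b b) _; move: sb' b0; lia.
case: (eqVneq (a ^+ 2 * f - b ^+ 2 * (c ^+ p)%:P) 0) => [|H]; last first.
  by rewrite gtNdvdp // size_polyXn.
move/eqP; rewrite subr_eq0 => /eqP eab _.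
have cp0 : (c ^+ p)%:P != 0 by rewrite polyC_eq0 expf_neq0.
case: (eqVneq a 0) => a0.
  split => //; apply/eqP; move/eqP: eab; rewrite a0 expr0n mul0r eq_sym mulf_eq0.
  by rewrite (negbTE cp0) orbF sqrf_eq0.
have b0 : b != 0.
  apply/eqP => b0; move/eqP: eab; rewrite b0 expr0n mul0r mulf_eq0 sqrf_eq0.
  by rewrite (negbTE a0) (negbTE f_neq0).
have [r rrs] : exists r, r \in rs by case: (rs) rsN => // r s _; exists r; rewrite mem_head.
have := congr1 (mup r) eab; rewrite !expr2 !mupM ?mulf_neq0 // mu_prod_XsubC.
rewrite count_uniq_mem // rrs [mup r (c ^+ p)%:P]mupNroot ?rootC ?expf_neq0 //.
by move/(congr1 odd); rewrite !oddD !addbb.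
Qed.

(** This guarantees that the auxiliary polynomial is nonzero. Modulo X^p only the block i = 0
    survives, and it vanishes by the preceding lemma; divide by X^p and repeat. *)
Lemma stepanov_indep (J : nat) (a b : nat -> {poly F}) :
  (forall i, ((size (a i)).*2 + d <= p.+1)%N) ->
  (forall i, ((size (b i)).*2 <= p.+1)%N) ->
  \sum_(i < J) (a i + b i * f ^+ h) * 'X^(i * p) = 0 ->
  forall i, (i < J)%N -> a i = 0 /\ b i = 0.
Proof.
elim: J a b => [//|J IH] a b sa sb; rewrite big_ord_recl mul0n expr0 mulr1.
set S := \sum_(i < J) _; move=> E.
have SE : S = 'X^p * \sum_(i < J) (a i.+1 + b i.+1 * f ^+ h) * 'X^(i * p).
  rewrite mulr_sumr; apply: eq_bigr => i _; rewrite /= mulrCA -exprD mulSn //.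
have [a0 b0] : a 0%N = 0 /\ b 0%N = 0.
  apply: dvdpXp_lin_eq0 => //; move/eqP: E; rewrite addr_eq0 => /eqP->.
  by rewrite dvdpNr SE dvdp_mulr.
case=> [//|i] iJ; apply: (IH (fun i => a i.+1) (fun i => b i.+1)) => //.
move/eqP: E; rewrite /= a0 b0 mul0r !add0r SE mulf_eq0 => /orP[|/eqP->//].
by rewrite -size_poly_eq0 size_polyXn.
Qed.

(** For k <= e this is the cofactor in (f^e a)^(k) = f^(e-k) [stepD e k a]: each derivative lowers
    the exponent of f by one, at the price of at most d in the size of the cofactor. *)
Fixpoint stepD (e k : nat) (a : {poly F}) : {poly F} :=
  if k is k'.+1 then
    let c := stepD e k' a in (e%:R - k'%:R) *: (f^`() * c) + f * c^`()
  else a.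

Lemma stepDB e k : {morph stepD e k : a b / a - b}.
Proof.
move=> a b; elim: k => //= k ->; rewrite derivB !mulrBr scalerBr; ring.
Qed.

Lemma size_stepD e k a : (size (stepD e k a) <= size a + k * d)%N.
Proof.
elim: k => [|k IH] /=; first by rewrite addn0.
have sf' : (size f^`() <= d)%N by have := lt_size_deriv f_neq0; rewrite size_f.
apply: leq_trans (size_polyD _ _) _; rewrite geq_max; apply/andP; split.
  apply: leq_trans (size_scale_leq _ _) _; apply: leq_trans (size_polyMleq _ _) _.
    by rewrite (leq_trans (leq_pred _)) // mulSn addnCA leq_add.
case: (eqVneq (stepD e k a)^`() 0) => [->|c0]; first by rewrite mulr0 size_poly0.
apply: leq_trans (size_polyMleq _ _) _; rewrite size_f.
have c'0 : stepD e k a != 0 by apply: contraNneq c0 => ->; rewrite deriv0.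
by rewrite addSn /= mulSn addnCA leq_add2l (leq_trans _ IH) // ltnW // lt_size_deriv.
Qed.

Let deriv_Xp (i : nat) : ('X^(i * p) : {poly F})^`() = 0.
Proof.
by rewrite derivXn -mulr_natr natrM -!polyC_natr (pcharf0 charF) polyC0 !mulr0.
Qed.

Let mul_deriv_fh : f * (f ^+ h)^`() = h%:R *: (f^`() * f ^+ h).
Proof.
rewrite deriv_exp; case: h => [|k]; first by rewrite mulr0n mulr0 scale0r.
by rewrite /= exprS -mulr_natl -mul_polyC polyC_natr; ring.
Qed.

(** X^(ip) has derivative 0 and f (f^h)' = h f' f^h, so differentiation keeps the shape (A + B f^h)
    X^(ip); the exponent c of f acts as c + h on B. *)
Lemma deriv_stepanov (c : nat) (A B : {poly F}) (i : nat) :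
  c%:R * (f^`() * ((A + B * f ^+ h) * 'X^(i * p)))
    + f * ((A + B * f ^+ h) * 'X^(i * p))^`() =
  ((c%:R *: (f^`() * A) + f * A^`()) +
   ((c + h)%:R *: (f^`() * B) + f * B^`()) * f ^+ h) * 'X^(i * p).
Proof.
rewrite derivM deriv_Xp mulr0 addr0 derivD derivM natrD.
transitivity ((c%:R%:P * (f^`() * (A + B * f ^+ h))
  + (f * A^`() + (f * B^`() * f ^+ h + B * (f * (f ^+ h)^`())))) * 'X^(i * p)).
  by rewrite polyC_natr; ring.
rewrite mul_deriv_fh -!mul_polyC !polyCD; ring.
Qed.

Lemma derivn_stepanov (l k J : nat) (a b : nat -> {poly F}) : (k <= l)%N ->
  (f ^+ l * \sum_(i < J) (a i + b i * f ^+ h) * 'X^(i * p))^`(k) =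
  f ^+ (l - k) *
  \sum_(i < J) (stepD l k (a i) + stepD (l + h) k (b i) * f ^+ h) * 'X^(i * p).
Proof.
elim: k => [|k IH] kl; first by rewrite derivn0 subn0.
rewrite derivnS IH; last exact: ltnW.
rewrite -(subnSK kl); move: (l - k.+1)%N (subnSK kl) => e eE.
set S := \sum_(i < J) _.
rewrite deriv_expM.
congr (_ * _).
pose T (i : nat) := (stepD l k (a i) + stepD (l + h) k (b i) * f ^+ h) * 'X^(i * p).
transitivity (\sum_(i < J) (e.+1%:R * (f^`() * T i) + f * (T i)^`())).
  by rewrite /S (big_morph _ (@derivD F) (deriv0 F)) !mulr_sumr big_split.
apply: eq_bigr => i _; rewrite [LHS]deriv_stepanov /=.
have lk : (k <= l)%N := ltnW kl.
have e1 : e.+1%:R = (l%:R - k%:R : F) by rewrite eE natrB.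
have e2 : (e.+1 + h)%:R = ((l + h)%:R - k%:R : F).
  by rewrite natrD e1 natrD addrAC.
by rewrite e1 e2.
Qed.

(** Since x^p = x, the blocks X^(ip) take the value x^i, and the derivative at x is governed by a
    polynomial of low degree. Where f(x)^h is constant this polynomial is the same for all x, so the
    number of conditions does not grow with the number of points. *)
Lemma stepanov_root (l k J : nat) (a b : nat -> {poly F}) (x : F) : (k <= l)%N ->
  \sum_(i < J) (stepD l k (a i) + (f.[x] ^+ h) *: stepD (l + h) k (b i)) * 'X^i = 0 ->
  root (f ^+ l * \sum_(i < J) (a i + b i * f ^+ h) * 'X^(i * p))^`(k) x.
Proof.
move=> kl Q0; rewrite /root derivn_stepanov // hornerM mulf_eq0; apply/orP; right.
apply/eqP; have := congr1 (fun q => q.[x]) Q0; rewrite horner0 => <-.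
rewrite !horner_sum; apply: eq_bigr => i _.
rewrite !hornerM !hornerD hornerM hornerZ horner_exp !hornerXn mulrC.
by rewrite mulnC exprM -cardF expf_card mulrC [_.[x] * _]mulrC.
Qed.

(* Pigeonhole: there are more tuples (a, b) than values of the vanishing
   conditions, so two tuples share their values; take the difference. *)
Lemma stepanov_aux (L n : nat) (eps : F) :
  (n.*2 + d <= p)%N -> (2 * L <= p)%N -> (L * (2 * L * d + L.+1) < n)%N ->
  exists a b : nat -> {poly F},
  [/\ forall i, (size (a i) <= n)%N, forall i, (size (b i) <= n)%N,
     exists2 i, (i < L.+1)%N & (a i != 0) || (b i != 0) &
     forall k, (k < 2 * L)%N ->
       \sum_(i < L.+1) (stepD (2 * L) k (a i) + eps *: stepD (2 * L + h) k (b i)) * 'X^i = 0].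
Proof.
move=> nd lp nL; pose l := (2 * L)%N; pose m := (n + l * d + L.+1)%N.
pose Q k (a b : 'I_L.+1 -> {poly F}) := \sum_(i < L.+1)
  (stepD l k (a i) + eps *: stepD (l + h) k (b i)) * 'X^i.
pose D := {ffun 'I_L.+1 -> 'rV[F]_n * 'rV[F]_n}.
pose Phi (u : D) : {ffun 'I_l -> 'rV[F]_m} :=
  [ffun k : 'I_l => poly_rV (Q k (fun i => rVpoly (u i).1) (fun i => rVpoly (u i).2))].
have szQ k (a b : 'I_L.+1 -> {poly F}) : (k < l)%N -> (forall i, (size (a i) <= n)%N) ->
    (forall i, (size (b i) <= n)%N) -> (size (Q k a b) <= m)%N.
  move=> kl sa sb; apply: leq_trans (size_sum _ _ _) _; apply/bigmax_leqP => i _.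
  have sD e (c : {poly F}) : (size c <= n)%N -> (size (stepD e k c) <= n + l * d)%N.
    move=> sc; apply: leq_trans (size_stepD _ _ _) _.
    by rewrite leq_add // leq_mul2r ltnW ?orbT.
  apply: leq_trans (size_polyMleq _ _) _; rewrite size_polyXn addnS /=.
  apply: leq_add; last by rewrite ltnW.
  apply: leq_trans (size_polyD _ _) _; rewrite geq_max sD //=.
  by apply: leq_trans (size_scale_leq _ _) _; exact: sD.
(* Both cardinals are powers of p, with exponents 2n(L+1) for the tuples and 2L(n + 2Ld + L+1) for
   the conditions; the last hypothesis is exactly the inequality between them. *)
have /injectivePn[u [v uv Puv]] : ~~ injectiveb Phi.
  apply/negP => /injectiveP/leq_card; apply/negP; rewrite -ltnNge.
  rewrite !card_ffun !card_ord card_prod !card_mx !mul1n cardF -expnD -!expnM.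
  by rewrite ltn_exp2l ?prime_gt1 // /m /l; nia.
exists (fun i => rVpoly (u (inord i)).1 - rVpoly (v (inord i)).1),
       (fun i => rVpoly (u (inord i)).2 - rVpoly (v (inord i)).2).
have szr (w : 'rV[F]_n) : (size (rVpoly w) <= n)%N by exact: size_poly.
have szB (w1 w2 : 'rV[F]_n) : (size (rVpoly w1 - rVpoly w2)%R <= n)%N.
  by rewrite (leq_trans (size_polyD _ _)) // size_polyN geq_max !szr.
split => //.
  have /existsP[i ui] : [exists i, u i != v i].
    by apply: contraR uv; rewrite negb_exists => /forallP H; apply/eqP/ffunP => i;
      apply/eqP; have := H i; rewrite negbK.
  exists i => //; rewrite inord_val; apply: contraR ui.
  rewrite negb_or !negbK !subr_eq0 => /andP[/eqP/(can_inj (@rVpolyK _ _)) e1].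
  by move=> /eqP/(can_inj (@rVpolyK _ _)) e2; apply/eqP/injective_projections.
move=> k kl.
have /(congr1 rVpoly) := congr1 (fun z : {ffun _} => z (Ordinal kl)) Puv.
rewrite !ffunE !poly_rV_K ?szQ //= => /eqP; rewrite -subr_eq0 => /eqP; apply: etrans.
rewrite /Q -sumrB; apply: eq_bigr => i _; rewrite !inord_val !stepDB scalerBr.
rewrite -/l; ring.
Qed.

(** Each counted point is a root of multiplicity 2L of a nonzero polynomial of size at most 2Ld + n
    + hd + Lp, where 2n <= p - d and 2h < p. Dividing by 4L gives p/2 + (d+1)p/(4L) + d. *)
Lemma stepanov_count (L : nat) (eps : F) :
  (2 * L * (2 * L * d + L.+1) + d + 2 <= p)%N ->
  (4 * L * #|[set x : F | f.[x] ^+ h == eps]| <= 2 * L * p + d.+1 * p + 4 * L * d)%N.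
Proof.
(* The largest size of the coefficients that the independence lemma allows. *)
move=> pL; pose n := ((p - d)./2)%N.
have n2 : (n.*2 + d <= p)%N by rewrite /n; lia.
have lp : (2 * L <= p)%N by nia.
have nL : (L * (2 * L * d + L.+1) < n)%N by rewrite /n; nia.
have [a [b [sa sb [i0 i0L ab0] Q0]]] := stepanov_aux eps n2 lp nL.
set l := (2 * L)%N in lp Q0.
pose S : {poly F} := \sum_(i < L.+1) (a i + b i * f ^+ h) * 'X^(i * p).
have S0 : S != 0.
  apply: contraTneq ab0 => S0; rewrite negb_or !negbK.
  have [|||-> ->//] := @stepanov_indep L.+1 a b _ _ S0 i0.
  - by move=> i; rewrite (leq_trans _ (leqW n2)) // leq_add2r leq_double.
  - by move=> i; rewrite (leq_trans _ (leqW n2)) // (leq_trans _ (leq_addr _ _)) // leq_double.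
  - exact: i0L.
  - by rewrite !eqxx.
have P0 : f ^+ l * S != 0 by rewrite mulf_neq0 // expf_neq0.
have us : uniq (enum [set x : F | f.[x] ^+ h == eps]) by exact: enum_uniq.
have := size_gt_multiple_roots P0 us (l := l).
have -> : size (enum [set x : F | f.[x] ^+ h == eps]) = #|[set x : F | f.[x] ^+ h == eps]|.
  by rewrite cardE.
have H : forall x, x \in enum [set x : F | f.[x] ^+ h == eps] -> ('X - x%:P) ^+ l %| f ^+ l * S.
  move=> x; rewrite mem_enum inE => /eqP fx.
  apply: (dvdp_derivn_root charF) => // k kl; apply: stepanov_root; first exact: ltnW.
  by rewrite fx; exact: Q0.
move=> /(_ H).
have sS : (size S <= n + h * d + L * p)%N.
  apply: leq_trans (size_sum _ _ _) _; apply/bigmax_leqP => i _.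
  apply: leq_trans (size_polyMleq _ _) _; rewrite size_polyXn addnS /=.
  apply: leq_add; last by rewrite leq_mul2r -ltnS ltn_ord orbT.
  apply: leq_trans (size_polyD _ _) _; rewrite geq_max (leq_trans (sa i)) ?leq_addr //=.
  apply: leq_trans (size_polyMleq _ _) _.
  have := size_poly_exp_leq f h; rewrite size_f /= mulnC => sfh.
  by rewrite -subn1 leq_subLR add1n -addnS leq_add ?sb.
have sP : (size (f ^+ l * S)%R <= l * d + (n + h * d + L * p))%N.
  apply: leq_trans (size_polyMleq _ _) _.
  have := size_poly_exp_leq f l; rewrite size_f /= mulnC => sfl.
  by have := leq_add sfl sS; rewrite addSn; case: (_ + _)%N => // s; rewrite ltnS.
move=> /leq_trans-/(_ _ sP); rewrite /l; move: n2 pE; clear.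
move: #|_| => N; rewrite -/d; nia.
Qed.

End Stepanov.

(** * Correlations of the quadratic character *)

(** Euler's criterion, written as a difference of two indicators so that a character sum is a
    difference of two of the counts in Stepanov's method. *)
Definition qchar (F : finFieldType) (a : F) : int :=
  (a ^+ #|F|./2 == 1)%:Z - (a ^+ #|F|./2 == -1)%:Z.

Section QuadraticCharacter.
Variables (F : finFieldType) (p : nat).
Hypotheses (p_pr : prime p) (p_odd : odd p) (cardF : #|F| = p).
Implicit Types a b c x : F.

Let h := p./2.

Let pE : p = (h.*2).+1. Proof. by rewrite -[LHS]odd_double_half p_odd. Qed.

Let h_gt0 : (0 < h)%N.
Proof. by have := prime_gt1 p_pr; rewrite pE; lia. Qed.

Lemma oppr1_neq1 : -1 != 1 :> F.
Proof.
have charF : p \in [pchar F] by apply: (@card_finPcharP _ p 1); rewrite ?expn1.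
rewrite eq_sym -addr_eq0 -(natrD F 1 1) -(dvdn_pcharf charF).
by apply/negP => /dvdn_leq-/(_ isT); have := prime_gt1 p_pr; rewrite pE; lia.
Qed.

Lemma exp_half_card a : a != 0 -> a ^+ h = 1 \/ a ^+ h = -1.
Proof.
move=> a0; have : (a ^+ h) ^+ 2 == 1.
  rewrite -exprM muln2; apply/eqP/(mulfI a0); rewrite -exprS -pE mulr1.
  by rewrite -cardF expf_card.
by rewrite sqrf_eq1 => /orP[] /eqP->; [left|right].
Qed.

Lemma qchar0 : qchar (0 : F) = 0.
Proof.
by rewrite /qchar cardF expr0n gtn_eqF //= eq_sym oner_eq0 eq_sym oppr_eq0 oner_eq0.
Qed.

Lemma qchar_neq0 a : a != 0 ->
  (a ^+ h = 1 /\ qchar a = 1) \/ (a ^+ h = -1 /\ qchar a = -1).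
Proof.
move=> a0; rewrite /qchar cardF -/h; case: (exp_half_card a0) => ->; [left|right].
  by rewrite eqxx eq_sym (negbTE oppr1_neq1).
by rewrite eqxx (negbTE oppr1_neq1).
Qed.

Lemma qcharM : {morph @qchar F : a b / a * b}.
Proof.
move=> a b; have [->|a0] := eqVneq a 0; first by rewrite !mul0r qchar0 mul0r.
have [->|b0] := eqVneq b 0; first by rewrite !mulr0 qchar0 mulr0.
have ab0 : a * b != 0 by rewrite mulf_neq0.
have := exprMn h a b; case: (qchar_neq0 ab0) => -[-> ->];
case: (qchar_neq0 a0) => -[-> ->]; case: (qchar_neq0 b0) => -[-> ->];
rewrite ?mulrNN ?mulr1 ?mul1r => // /eqP;
by rewrite ?(negbTE oppr1_neq1) // eq_sym (negbTE oppr1_neq1).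
Qed.

Lemma qchar1 : qchar (1 : F) = 1.
Proof. by rewrite /qchar expr1n eqxx eq_sym (negbTE oppr1_neq1). Qed.

Lemma qchar_sqr a : a != 0 -> qchar a * qchar a = 1.
Proof. by move=> /qchar_neq0 [] [_ ->]. Qed.

Lemma qchar_prod (I : Type) (s : seq I) (P : pred I) (f : I -> F) :
  qchar (\prod_(i <- s | P i) f i) = \prod_(i <- s | P i) qchar (f i).
Proof. by elim/big_rec2: _ => [|i y x _ <-]; rewrite ?qchar1 ?qcharM. Qed.

Lemma finField_primitive_root :
  exists g : F, [/\ g != 0, g ^+ h = -1 & forall a, a != 0 -> exists k, a = g ^+ k].
Proof.
have /cyclicP[u uE] := field_unit_group_cyclic [set: {unit F}].
have ordu : #[u]%g = (h.*2)%N by rewrite /order -uE card_finField_unit cardF {1}pE.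
have u0 : val u != 0 by rewrite -unitfE; exact: valP.
exists (val u); split => //.
  case: (exp_half_card u0) => // uh.
  have : (u ^+ h == 1)%g by apply/eqP/val_inj; rewrite FinRing.val_unitX.
  by rewrite -order_dvdn ordu => /dvdn_leq-/(_ h_gt0); lia.
move=> a a0; have ua : a \is a GRing.unit by rewrite unitfE.
have : FinRing.unit F ua \in <[u]>%g by rewrite -uE inE.
by case/cycleP => k /(congr1 val); rewrite FinRing.val_unitX /= => ->; exists k.
Qed.

(** For a = g^k with g primitive, a^h = (-1)^k, so the character is 1 exactly when k is even. *)
Lemma qchar_squareP a : a != 0 -> reflect (exists b, b ^+ 2 = a) (qchar a == 1).
Proof.
move=> a0; apply: (iffP eqP) => [qa|[b ba]]; last first.
  have b0 : b != 0 by apply: contraNneq a0 => b0; rewrite -ba b0 expr0n.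
  by rewrite -ba expr2 qcharM qchar_sqr.
have [g [g0 gh gP]] := finField_primitive_root; have [k ak] := gP a a0; exists (g ^+ k./2).
have ah : a ^+ h = 1 by case: (qchar_neq0 a0) => -[//]; rewrite qa.
move: ah; rewrite ak -exprM mulnC exprM gh -signr_odd.
case: (boolP (odd k)) => ok; first by rewrite expr1 => /eqP; rewrite (negbTE oppr1_neq1).
by move=> _; rewrite -exprM muln2 -[in RHS](odd_double_half k) (negbTE ok).
Qed.

Lemma sum_qchar : \sum_x qchar (x : F) = 0.
Proof.
have [g [g0 gh _]] := finField_primitive_root.
have qg : qchar g = -1.
  by rewrite /qchar cardF -/h gh eqxx (negbTE oppr1_neq1).
have : \sum_x qchar (x : F) = - \sum_x qchar (x : F).
  rewrite -mulN1r -qg mulr_sumr [LHS](reindex_inj (mulfI g0)) /=.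
  by apply: eq_bigr => x _; rewrite qcharM.
lia.
Qed.

(** For distinct shifts, translate to x (x + c) = x^2 (1 + c/x) and substitute y = 1/x: the full sum
    over 1 + c y is 0, and the missing y = 0 accounts for -1. *)
Lemma sum_qchar_shift2 a b :
  \sum_x qchar (x + a) * qchar (x + b) = if a == b then p%:Z - 1 else -1.
Proof.
rewrite (reindex_inj (addIr (- a))) /=.
under eq_bigr do rewrite subrK -addrA.
have [->|ab] := eqVneq a b.
  rewrite (bigD1 0) //= qchar0 mul0r add0r.
  under eq_bigr => x x0 do rewrite addNr addr0 qchar_sqr //.
  rewrite sumr_const -[p in RHS]cardF [in RHS](cardD1 (0 : F)) inE add1n -natz -[in RHS]natr1 addrK.
  by congr (_%:R); apply: eq_card => x; rewrite !inE andbT.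
have c0 : - a + b != 0 by rewrite addrC subr_eq0 eq_sym.
rewrite (bigD1 0) //= qchar0 mul0r add0r.
transitivity (\sum_(x | x != 0) qchar (1 + (- a + b) * x^-1)).
  apply: eq_bigr => x x0.
  have -> : x + (- a + b) = x * (1 + (- a + b) * x^-1).
    by rewrite mulrDr mulr1 mulrCA divff // mulr1.
  by rewrite qcharM mulrA qchar_sqr // mul1r.
rewrite (reindex_inj (@invr_inj F)) /=.
under eq_bigl do rewrite invr_eq0.
under eq_bigr do rewrite invrK.
have : \sum_x qchar (1 + (- a + b) * x) = 0.
  rewrite -[RHS]sum_qchar [RHS](reindex_inj (addrI 1)) /=.
  by rewrite [RHS](reindex_inj (mulfI c0)).
by rewrite (bigD1 0) //= mulr0 addr0 qchar1 => /eqP; rewrite addrC addr_eq0 => /eqP.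
Qed.

(** Expand the square: the correlations are p - 1 on the diagonal and -1 off it, that is, p times
    the identity minus the all-ones matrix. *)
Lemma sum_qchar_lin_sqr (R : realDomainType) (I : finType) (m : I -> F) (b : I -> R) :
  injective m ->
  \sum_x (\sum_i b i * (qchar (x + m i))%:~R) ^+ 2
    = p%:R * (\sum_i b i ^+ 2) - (\sum_i b i) ^+ 2.
Proof.
move=> im.
transitivity (\sum_i \sum_j b i * b j * (\sum_x qchar (x + m i) * qchar (x + m j))%:~R).
  under eq_bigr do rewrite expr2 big_distrlr /=.
  rewrite exchange_big; apply: eq_bigr => i _; rewrite exchange_big; apply: eq_bigr => j _.
  by rewrite rmorph_sum mulr_sumr; apply: eq_bigr => x _; rewrite rmorphM /=; ring.
rewrite mulr_sumr expr2 big_distrlr -sumrB; apply: eq_bigr => i _ /=.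
rewrite (bigD1 i) //= [in RHS](bigD1 i) //= sum_qchar_shift2 eqxx opprD addrA; congr (_ + _).
  by rewrite rmorphB /=; ring.
rewrite -sumrN; apply: eq_bigr => j ji; rewrite sum_qchar_shift2 (inj_eq im) eq_sym (negbTE ji).
by rewrite rmorphN1 mulrN1.
Qed.

(** With N(1) + N(-1) >= p - d, the difference N(1) - N(-1) is at most 2 N(1) - p + d, and
    symmetrically. The 6L is 4L from the count plus 2L from the at most d roots. *)
Lemma sum_qchar_prod_aux (s : seq F) (L : nat) :
  uniq s -> 0 \notin s -> (0 < size s)%N ->
  (2 * L * (2 * L * size s + L.+1) + size s + 2 <= p)%N ->
  `|\sum_x \prod_(r <- s) qchar (x - r)| * (2 * L)%:Z
     <= ((size s).+1 * p + 6 * L * size s)%:Z.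
Proof.
move=> us s0 sN pL; set d := size s; pose f := \prod_(r <- s) ('X - r%:P).
pose N (e : F) := #|[set x : F | f.[x] ^+ h == e]|.
have fE x : f.[x] = \prod_(r <- s) (x - r).
  by rewrite horner_prod; apply: eq_bigr => r _; rewrite hornerXsubC.
have N1 (e : F) : (4 * L * N e <= 2 * L * p + d.+1 * p + 4 * L * d)%N.
  exact: (stepanov_count p_pr p_odd cardF us s0 sN e pL).
have N2 : (p <= N 1%R + N (- 1)%R + d)%N.
  rewrite -cardF /d -(card_uniqP us) -cardsT.
  pose S (e : F) := [set x : F | f.[x] ^+ h == e].
  rewrite -[#|s|]cardsE (leq_trans _ (leq_add (leq_card_setU (S 1) (S (-1))).1 (leqnn _))) //.
  rewrite (leq_trans _ (leq_card_setU _ _).1) //.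
  apply/subset_leq_card/fintype.subsetP => x _; rewrite !inE.
  have [xs|xs] := boolP (x \in s); first by rewrite orbT.
  have : f.[x] != 0 by rewrite -/(root f x) root_prod_XsubC.
  by case/exp_half_card => ->; rewrite eqxx ?orbT.
have -> : \sum_x \prod_(r <- s) qchar (x - r) = (N 1)%:Z - (N (- 1))%:Z.
  have NE (e : F) : (N e)%:Z = \sum_x (f.[x] ^+ h == e)%:Z.
    rewrite /N -sum1dep_card big_mkcond /= (big_morph Posz PoszD (erefl _)).
    by apply: eq_bigr => x _; case: eqP.
  rewrite !NE -sumrB; apply: eq_bigr => x _.
  by rewrite -qchar_prod -fE /qchar cardF.
move: (N1 1) (N1 (-1)) N2; move: (N 1) (N (-1)) => a b; nia.
Qed.

(** Stepanov's argument needs f(0) nonzero; translating by some c outside [s], which exists because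
    [s] has fewer than p elements, arranges this. *)
Lemma sum_qchar_prod (s : seq F) (L : nat) :
  uniq s -> (0 < size s)%N ->
  (2 * L * (2 * L * size s + L.+1) + size s + 2 <= p)%N ->
  `|\sum_x \prod_(r <- s) qchar (x - r)| * (2 * L)%:Z
     <= ((size s).+1 * p + 6 * L * size s)%:Z.
Proof.
move=> us sN pL.
have [c cs] : exists c : F, c \notin s.
  apply/existsP; rewrite -negb_forall; apply/forallP => /= sF.
  have : (#|F| <= size s)%N.
    by rewrite -(card_uniqP us) -cardsT; apply/subset_leq_card/fintype.subsetP => x _; rewrite sF.
  by rewrite cardF; lia.
have cK : cancel (fun x : F => x - c) (fun x => x + c) by move=> x; rewrite subrK.
have := @sum_qchar_prod_aux [seq x - c | x <- s] L.
rewrite size_map (map_inj_uniq (can_inj cK)) => /(_ us _ sN pL).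
rewrite (reindex_inj (addIr (- c))) /=.
under eq_bigr do (rewrite big_map; under eq_bigr do rewrite opprB addrA subrK).
by apply; apply: contra cs => /mapP[x xs /eqP]; rewrite eq_sym subr_eq0 => /eqP <-.
Qed.

(** The product of the 1 + e_i chi(x + m_i) is 2^n times the indicator of the pattern, unless some x
    + m_i is 0, which happens for at most n values of x. In its expansion the empty set gives p and
    every other subset a correlation sum. The exceptional x raise 6L to 8L. *)
Lemma qchar_pattern_count (I : finType) (m : I -> F) (e : I -> bool) (L : nat) :
  injective m ->
  (2 * L * (2 * L * #|I| + L.+1) + #|I| + 2 <= p)%N ->
  `|(2 ^ #|I|)%:Z * (#|[set x | [forall i, qchar (x + m i) == (-1) ^+ e i]]|)%:Z - p%:Z|
    * (2 * L)%:Z <= (2 ^ #|I| * (#|I|.+1 * p + 8 * L * #|I|))%:Z.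
Proof.
move=> im pL; set n := #|I|; set N := #|_|.
pose P (x : F) : int := \prod_i (1 + (-1) ^+ e i * qchar (x + m i)).
pose good (x : F) := [forall i, qchar (x + m i) == (-1) ^+ e i].
pose bad (x : F) := [exists i, x + m i == 0].
have pow2 : (2 ^ n)%:Z = 2 ^+ n by rewrite -natz natrX.
have fac x i : 0 <= 1 + (-1) ^+ e i * qchar (x + m i) <= 2.
  have [->|/qchar_neq0] := eqVneq (x + m i) 0; first by rewrite qchar0 mulr0.
  by case: (e i) => -[] [_ ->].
have PE x : `|P x - (2 ^ n)%:Z * (good x)%:Z| <= (2 ^ n)%:Z * (bad x)%:Z.
  have [bx|] := boolP (bad x).
    have P0 : 0 <= P x by apply: prodr_ge0 => i _; case/andP: (fac x i).
    have P2 : P x <= (2 ^ n)%:Z.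
      rewrite pow2 /n -prodr_const; apply: ler_prod => i _; exact: fac.
    by move: P0 P2; case: (good x); lia.
  rewrite negb_exists => /forallP xm; rewrite mulr0.
  have [/forallP gx|] := boolP (good x).
    rewrite mulr1 /P (eq_bigr (fun=> 2)); last first.
      by move=> i _; rewrite (eqP (gx i)) -expr2 sqrr_sign.
    by rewrite prodr_const -/n pow2 subrr.
  rewrite negb_forall => /existsP[i gi]; rewrite /P (bigD1 i) //=.
  have -> : 1 + (-1) ^+ e i * qchar (x + m i) = 0.
    by case: (qchar_neq0 (xm i)) gi => -[_ ->]; case: (e i).
  by rewrite mul0r mulr0 subrr.
have card_bad : (#|[set x | bad x]| <= n)%N.
  rewrite /n -cardsT; apply: leq_trans (leq_imset_card (fun i => - m i) _).
  apply/subset_leq_card/fintype.subsetP => x; rewrite inE => /existsP[i /eqP xi].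
  by apply/imsetP; exists i => //; apply/eqP; rewrite -addr_eq0 xi.
have sumN (b : pred F) : \sum_x (b x)%:Z = (#|[set x | b x]|)%:Z.
  rewrite -sum1dep_card [in RHS]big_mkcond /= (big_morph Posz PoszD (erefl _)).
  by apply: eq_bigr => x _; case: (b x).
have close : `|\sum_x P x - (2 ^ n)%:Z * N%:Z| <= (2 ^ n)%:Z * n%:Z.
  have -> : N%:Z = \sum_x (good x)%:Z by rewrite sumN.
  rewrite mulr_sumr -sumrB; apply: le_trans (ler_norm_sum _ _ _) _.
  apply: le_trans (ler_sum _ (fun x _ => PE x)) _.
  by rewrite -mulr_sumr sumN ler_wpM2l.
have sumP : `|\sum_x P x - p%:Z| * (2 * L)%:Z <= (2 ^ n * (n.+1 * p + 6 * L * n))%:Z.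
  pose c (J : {set I}) : int := \prod_(i in J) (-1) ^+ e i.
  pose Q (J : {set I}) := \sum_x \prod_(i in J) qchar (x + m i).
  have -> : \sum_x P x = \sum_(J : {set I}) c J * Q J.
    under [RHS]eq_bigr do rewrite mulr_sumr.
    rewrite [RHS]exchange_big; apply: eq_bigr => x _; rewrite /P.
    under eq_bigr do rewrite addrC.
    rewrite bigA_distr; apply: eq_big => [J|J _]; first by rewrite inE.
    by rewrite /c -big_split [RHS]big_mkcond.
  rewrite (bigD1 finset.set0) //= /c /Q.
  under [X in _ * X + _]eq_bigr do rewrite big_set0.
  rewrite big_set0 mul1r sumr_const cardF natz addrAC subrr add0r.
  have cQ J : J != finset.set0 -> `|c J * Q J| * (2 * L)%:Z <= (n.+1 * p + 6 * L * n)%:Z.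
    move=> J0; rewrite normrM (_ : `|c J| = 1) ?mul1r; last first.
      by rewrite normr_prod big1 // => i _; rewrite normr_sign.
    have Jn : (#|J| <= n)%N by exact: max_card.
    have := @sum_qchar_prod [seq - m i | i <- enum J] L.
    rewrite size_map -cardE map_inj_uniq ?enum_uniq; last by move=> i j /oppr_inj/im.
    rewrite card_gt0 => /(_ isT J0).
    under eq_bigr do (rewrite big_map; under eq_bigr do rewrite opprK; rewrite big_enum).
    move=> H; apply: le_trans (H _) _; first by nia.
    by rewrite lez_nat; nia.
  have := ler_norm_sum (index_enum {set I}) (fun J => c J * Q J) (fun J => J != finset.set0).
  move=> /(ler_wpM2r (ler0n _ (2 * L)))/le_trans; rewrite natz; apply.
  rewrite mulr_suml; apply: le_trans (ler_sum _ cQ) _.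
  rewrite sumr_const -mulr_natr natz -PoszM lez_nat mulnC leq_mul2r.
  by rewrite (leq_trans (max_card _)) ?orbT // -cardsT -powersetT card_powerset cardsT.
rewrite distrC in close.
have := ler_distD (\sum_x P x) ((2 ^ n)%:Z * N%:Z) p%:Z.
move: close sumP; set a := `|_ - _|; set b := `|_ - _|; set d := `|_ - _|.
move: (2 ^ n)%N (a) (b) (d); clear; nia.
Qed.

End QuadraticCharacter.

Local Open Scope classical_set_scope.
Local Open Scope ring_scope.
Local Open Scope complex_scope.

(** * Interpolation of the Fekete polynomial *)

Section ExponentialMap.
Variable R : realType.
Implicit Types x y : R.

Lemma e0 : e (0 : R) = 1.
Proof. by rewrite /e mulr0 cos0 sin0. Qed.

Lemma eD x y : e (x + y) = e x * e y.
Proof. by rewrite /e mulrDr cosD sinD; simpc; congr (_ +i* _); rewrite addrC. Qed.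

Lemma e1 : e (1 : R) = 1.
Proof. by rewrite /e mulr1 mulr_natl cos2pi sin2pi. Qed.

Lemma eN x : e (- x) = (e x)^-1.
Proof.
have ex : e x != 0.
  by apply: contraTneq (oner_neq0 R[i]) => ex; rewrite -e0 -(subrr x) eD ex mul0r eqxx.
by apply: (mulIf ex); rewrite -eD addNr e0 mulVf.
Qed.

Lemma eX n x : e (n%:R * x) = e x ^+ n.
Proof.
elim: n => [|n IH]; first by rewrite mul0r e0.
by rewrite -natr1 mulrDl mul1r eD IH exprSr.
Qed.

Lemma e_nat n : e (n%:R : R) = 1.
Proof. by rewrite -[n%:R]mulr1 eX e1 expr1n. Qed.

Lemma cabs_e x : cabs (e x) = 1.
Proof. by rewrite /= cos2Dsin2 sqrtr1. Qed.

Lemma e_natDdiv (p n : nat) x : (0 < p)%N -> e (x + (n * p)%:R / p%:R) = e x.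
Proof.
by move=> p0; rewrite eD natrM mulfK ?pnatr_eq0 -?lt0n // e_nat mulr1.
Qed.

End ExponentialMap.

Lemma sum_Fp (V : nmodType) (p : nat) (f : nat -> V) : prime p ->
  \sum_(x : 'F_p) f (val x) = \sum_(n < p) f n.
Proof.
move=> /Fp_cast; move: (_.+2) => q qp.
by case: _ / qp.
Qed.

Section LegendreQchar.
Variables (p : nat).
Hypotheses (p_pr : prime p) (p_odd : odd p).

Lemma legendreE n : legendre p n = qchar (n%:R : 'F_p).
Proof.
have cF := card_Fp p_pr.
have z0 : ((n%:R : 'F_p) == 0) = (p %| n)%N by rewrite (dvdn_pcharf (pchar_Fp p_pr)).
rewrite /legendre -z0; have [->|n0] := eqVneq (n%:R : 'F_p) 0.
  by rewrite (qchar0 p_pr p_odd cF).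
have -> : [exists x : 'I_p, (x ^ 2 == n %[mod p])%N] = (qchar (n%:R : 'F_p) == 1).
  apply/existsP/(qchar_squareP p_pr p_odd cF n0) => [[x /eqP xn]|[b bn]].
    by exists (x : nat)%:R; rewrite -natrX -(Fp_nat_mod p_pr (x ^ 2)) xn (Fp_nat_mod p_pr).
  exists (cast_ord (Fp_cast p_pr) b); apply/eqP => /=.
  by rewrite -(val_Fp_nat p_pr) -[RHS](val_Fp_nat p_pr) natrX natr_Zp bn.
by case: (qchar_neq0 p_pr p_odd cF n0) => -[_ ->].
Qed.

End LegendreQchar.

(** * Gauss sums and interpolation at the p-th roots of unity *)

Section Kernel.
Variables (R : realType) (p : nat).
Hypotheses (p_pr : prime p) (p_odd : odd p).
Local Notation F := 'F_p.
Let cF := card_Fp p_pr.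
Let p0 : (0 < p)%N := prime_gt0 p_pr.
Let h := p./2.

Definition addchar (q : nat) (x : 'F_q) : R[i] := e ((val x)%:R / q%:R : R).
Local Notation psi := (@addchar p).

Lemma addchar_nat n : psi n%:R = e (n%:R / p%:R : R).
Proof.
rewrite /addchar /= val_Fp_nat // [in RHS](divn_eq n p) addnC natrD mulrDl.
by rewrite e_natDdiv.
Qed.

Lemma addcharD : {morph psi : x y / x + y >-> x * y}.
Proof.
move=> x y; rewrite -[x]natr_Zp -[y]natr_Zp -natrD !addchar_nat.
by rewrite natrD mulrDl eD.
Qed.

Lemma addchar0 : psi 0 = 1. Proof. by rewrite /addchar mul0r e0. Qed.

Lemma addcharN x : psi (- x) = (psi x)^-1.
Proof.
have x0 : psi x != 0.
  apply: contraTneq (oner_neq0 R[i]) => x0.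
  by rewrite -addchar0 -(subrr x) addcharD x0 mul0r eqxx.
by apply: (mulIf x0); rewrite -addcharD addNr addchar0 mulVf.
Qed.

Lemma addchar_int (m : int) : psi m%:~R = e (m%:~R / p%:R : R).
Proof.
case: m => n; first by rewrite -pmulrn addchar_nat.
by rewrite NegzE !mulrNz addcharN mulNr eN -pmulrn addchar_nat.
Qed.

(* The lower bound on |e x - 1| is only needed to see that psi is non-trivial. *)
Hypothesis psi_neq1 : forall x : F, x != 0 -> psi x != 1.

Lemma sum_addchar (c : F) : \sum_(y : F) psi (y * c) = if c == 0 then p%:R else 0.
Proof.
case: eqP => [->|/eqP c0].
  by under eq_bigr do rewrite mulr0 addchar0; rewrite sumr_const cF.
have : psi c * \sum_(y : F) psi (y * c) = \sum_(y : F) psi (y * c).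
  rewrite mulr_sumr [RHS](reindex_inj (addIr 1)) /=; apply: eq_bigr => y _.
  by rewrite mulrDl mul1r addcharD mulrC.
move/eqP; rewrite -subr_eq0 -{2}[\sum_ _ _]mul1r -mulrBl mulf_eq0 subr_eq0.
by rewrite (negbTE (psi_neq1 c0)) => /eqP.
Qed.

Definition gauss_sum : R[i] := \sum_(x : F) (qchar x)%:~R * psi x.
Local Notation tau := gauss_sum.

Lemma gauss_sum_twist (y : F) : \sum_(x : F) (qchar x)%:~R * psi (x * y) = (qchar y)%:~R * tau.
Proof.
have [->|y0] := eqVneq y 0.
  rewrite (qchar0 p_pr p_odd cF) mul0r; under eq_bigr do rewrite mulr0 addchar0 mulr1.
  by rewrite -rmorph_sum /= (sum_qchar p_pr p_odd cF).
rewrite /gauss_sum mulr_sumr [RHS](reindex_inj (mulIf y0)) /=; apply: eq_bigr => x _.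
rewrite (qcharM p_pr p_odd cF) mulrA -rmorphM /= [qchar x * _]mulrC mulrA.
by rewrite (qchar_sqr p_pr p_odd cF y0) mul1r.
Qed.

(** If [tau] were 0, all Fourier coefficients of the quadratic character would vanish by
    [gauss_sum_twist], and Fourier inversion at 1 would give p = 0. *)
Lemma gauss_sum_neq0 : tau != 0.
Proof.
apply/eqP => tau0.
have : \sum_(y : F) (\sum_(x : F) (qchar x)%:~R * psi (x * y)) * psi (- y) = p%:R.
  under eq_bigr do rewrite mulr_suml.
  rewrite exchange_big /= (bigD1 1) //= [X in _ + X]big1 ?addr0.
    under eq_bigr do rewrite -mulrA -addcharD mul1r subrr addchar0 mulr1.
    by rewrite sumr_const cF (qchar1 p_pr p_odd cF).
  move=> x x1; under eq_bigr => y _.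
    rewrite -mulrA -addcharD -[- y]mulrN1 [x * y]mulrC -mulrDr.
    over.
  by rewrite -mulr_sumr sum_addchar subr_eq0 (negbTE x1) mulr0.
rewrite big1 => [/esym/eqP|y _]; first by rewrite pnatr_eq0 -leqn0 leqNgt p0.
by rewrite gauss_sum_twist tau0 mulr0 mul0r.
Qed.

Lemma horner_fekete (z : R[i]) :
  (fekete R p).[z] = \sum_(x : F) (qchar x)%:~R * z ^+ (val x).
Proof.
transitivity (\sum_(n < p) (legendre p n)%:~R * z ^+ n).
  rewrite -(big_mkord xpredT (fun n => (legendre p n)%:~R * z ^+ n)) big_ltn //.
  rewrite {1}/legendre dvdn0 mul0r add0r /fekete horner_sum.
  by apply: eq_bigr => n _; rewrite hornerZ hornerXn.
rewrite -(sum_Fp (fun n => (legendre p n)%:~R * z ^+ n)) //.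
by apply: eq_bigr => x _; rewrite legendreE // natr_Zp.
Qed.

(** For q > 0, this is the Lagrange basis function of the q-th roots of unity at e(u/q): it is 1
    when u is a multiple of q and 0 at the other integers. *)
Definition dirichlet (q : nat) (u : R) : R[i] :=
  q%:R^-1 * \sum_(n < q) e (u * n%:R / q%:R).

(* Discrete Fourier inversion, i.e. Lagrange interpolation of the polynomial at
   the p-th roots of unity, where its values are qchar j * tau. *)
Lemma Gp_funE (k : nat) (t : I01 R) :
  Gp_fun p k t = \sum_(j < p) (qchar (k%:R + (j%:Z - h%:Z)%:~R : F))%:~R
                   * dirichlet p (val t - (j%:Z - h%:Z)%:~R).
Proof.
pose E (n : nat) : R[i] := e (val t * n%:R / p%:R).
pose K (a : F) : R[i] := p%:R^-1 * \sum_(x : F) E (val x) * psi (- (a * x)).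
have KE (m : int) : K m%:~R = dirichlet p (val t - m%:~R).
  rewrite /K /dirichlet; congr (_ * _).
  rewrite -(sum_Fp (fun n => e ((val t - m%:~R) * n%:R / p%:R))) //.
  apply: eq_bigr => x _; rewrite -[X in psi (- (_ * X))]natr_Zp.
  rewrite -[(val x)%:R]/((val x)%:~R) pmulrn -rmorphM -rmorphN /= addchar_int -eD.
  by congr e; rewrite rmorphN rmorphM /= -!pmulrn; ring.
transitivity (\sum_(a : F) (qchar (k%:R + a))%:~R * K a); last first.
  (* The kernel depends on residues only; they are listed as -h, ..., h so that truncation will be
     symmetric. *)
  rewrite (reindex_inj (addIr (- h%:R))) /=.
  rewrite -(sum_Fp (fun n => (qchar (k%:R + (n%:Z - h%:Z)%:~R : F))%:~R
                   * dirichlet p (val t - (n%:Z - h%:Z)%:~R))) //.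
  apply: eq_bigr => x _; rewrite -KE.
  have -> // : ((val x)%:Z - h%:Z)%:~R = x - h%:R :> F.
  by rewrite rmorphB /= -!pmulrn natr_Zp.
have tau0 := gauss_sum_neq0.
have -> : Gp_fun p k t = (\sum_(n : F) (qchar n)%:~R * (E (val n) * psi (k%:R * n))) / tau.
  rewrite /Gp_fun !horner_fekete; congr (_ / _); apply: eq_bigr => x _; congr (_ * _).
    rewrite -eX -[X in psi (_ * X)]natr_Zp -natrM addchar_nat -eD natrM; congr e.
    by rewrite /=; ring.
  by rewrite -eX.
apply: (mulIf tau0); rewrite divfK // mulr_suml.
rewrite [RHS](reindex_inj (addIr (- k%:R))) /=.
under [RHS]eq_bigr => y _.
  rewrite [k%:R + _]addrC subrK mulrAC -gauss_sum_twist mulr_suml.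
  under eq_bigr => x _ do rewrite /K mulrCA mulr_sumr.
  over.
rewrite exchange_big /=; apply: eq_bigr => x _.
rewrite -mulr_sumr exchange_big /= (bigD1 x) //= [X in _ + X]big1 ?addr0; last first.
  move=> n nx; under eq_bigr => y _.
    rewrite mulrBl opprB addcharD -!mulrA [psi (x * y) * _]mulrC -!mulrA -addcharD.
    rewrite [x * y]mulrC -mulrN -mulrDr [- n + x]addrC.
    over.
  by rewrite -!mulr_sumr sum_addchar subr_eq0 eq_sym (negbTE nx) !mulr0.
under eq_bigr => y _.
  rewrite mulrBl opprB addcharD -!mulrA [psi (x * y) * _]mulrC -!mulrA -addcharD.
  rewrite [x * y]mulrC addNr addchar0.
  over.
by rewrite sumr_const cF mulr1 -(mulr_natl (_ * _) p) mulKf // pnatr_eq0 -lt0n.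
Qed.

End Kernel.

(** * Estimates for the exponential map *)

Section ComplexModulus.
Variable R : realType.
Implicit Types z w : R[i].

Lemma cabs_ge0 z : 0 <= cabs z.
Proof. by case: z => a b; rewrite sqrtr_ge0. Qed.

Lemma cabs_le_add z w : cabs (z + w) <= cabs z + cabs w.
Proof. exact: le_normcD. Qed.

Lemma cabs_sub_le z w : cabs (z - w) <= cabs z + cabs w.
Proof. by rewrite -[cabs w]normcN; exact: le_normcD. Qed.

Lemma cabs_sum (I : Type) (s : seq I) (P : pred I) (f : I -> R[i]) :
  cabs (\sum_(i <- s | P i) f i) <= \sum_(i <- s | P i) cabs (f i).
Proof.
elim/big_rec2: _ => [|i y x _ h]; first by rewrite normc0.
by apply: le_trans (cabs_le_add _ _) _; rewrite lerD2l.
Qed.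

Lemma cabs_real (x : R) : cabs x%:C = `|x|.
Proof. by rewrite /= expr0n /= addr0 sqrtr_sqr. Qed.

Lemma cabs_imag (x : R) : cabs (0 +i* x) = `|x|.
Proof. by rewrite /= expr0n /= add0r sqrtr_sqr. Qed.

Lemma complex_natr n : (n%:R : R[i]) = (n%:R : R)%:C.
Proof. by rewrite rmorph_nat. Qed.

Lemma cabs_nat n : cabs (n%:R : R[i]) = n%:R.
Proof. by rewrite complex_natr cabs_real normr_nat. Qed.

Lemma cabs_le_ReIm z : cabs z <= `|complex.Re z| + `|complex.Im z|.
Proof.
have {1}-> : z = (complex.Re z)%:C + (0 +i* complex.Im z) by case: z => a b; simpc.
by apply: le_trans (cabs_le_add _ _) _; rewrite cabs_real cabs_imag.
Qed.

Lemma Re_le_cabs z : `|complex.Re z| <= cabs z.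
Proof. by rewrite -lecR; exact: normc_ge_Re. Qed.

Lemma Im_le_cabs z : `|complex.Im z| <= cabs z.
Proof.
case: z => a b /=; rewrite -sqrtr_sqr ler_sqrt ?lerDr ?sqr_ge0 //.
by rewrite addr_ge0 ?sqr_ge0.
Qed.

Lemma cabs_distC z w : cabs (z - w) = cabs (w - z).
Proof. by rewrite -opprB normcN. Qed.

End ComplexModulus.

Section TrigonometricEstimates.
Variable R : realType.
Implicit Types x y t u : R.

Lemma norm_sin_le x : `|sin x| <= `|x|.
Proof.
wlog x0 : x / 0 <= x.
  move=> H; have [/H//|/ltW x0] := leP 0 x.
  by have := H (- x); rewrite sinN !normrN oppr_ge0; exact.
have [c _] := @MVT_segment R sin cos 0 x x0 (fun z _ => is_derive_sin z)
  (continuous_subspaceT (@continuous_sin R)).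
rewrite sin0 !subr0 => ->; rewrite normrM ler_piMl //; exact: cos_max.
Qed.

Lemma cosB1E x : cos x - 1 = - (2 * sin (x / 2) ^+ 2).
Proof. by rewrite [in LHS](splitr x) -mulr2n cos_mulr2n cos2sin2; ring. Qed.

Lemma norm_cosB1_le x : `|cos x - 1| <= `|x|.
Proof.
rewrite cosB1E normrN normrM normrX ger0_norm // expr2 mulrA.
have := norm_sin_le (x / 2); have := sin_max (x / 2).
rewrite normrM [`|_^-1|]ger0_norm ?invr_ge0 //; have := normr_ge0 (sin (x / 2)).
have := normr_ge0 x; nra.
Qed.

Lemma norm_cosB1_le_sqr x : `|cos x - 1| <= x ^+ 2.
Proof.
rewrite cosB1E normrN normrM normrX ger0_norm // -[x ^+ 2]real_normK ?num_real //.
have := norm_sin_le (x / 2).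
rewrite normrM [`|_^-1|]ger0_norm ?invr_ge0 //; have := normr_ge0 (sin (x / 2)).
have := normr_ge0 x; nra.
Qed.

Lemma norm_sinB_le_sqr x : `|sin x - x| <= x ^+ 2.
Proof.
wlog x0 : x / 0 <= x.
  move=> H; have [/H//|/ltW x0] := leP 0 x.
  by have := H (- x); rewrite sinN -opprD normrN sqrrN oppr_ge0; exact.
have df z : z \in `]0, x[%R -> is_derive z 1 (fun y => sin y - y) (cos z - 1).
  by move=> _; apply: is_deriveB.
have cf : {within `[0, x], continuous (fun y => sin y - y)}.
  apply: continuous_subspaceT => z; apply: continuousB; first exact: continuous_sin.
  exact: cvg_id.
have [c] := MVT_segment x0 df cf.
rewrite in_itv /= sin0 !subr0 => /andP[c0 cx] ->; rewrite normrM (ger0_norm x0) expr2.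
by rewrite ler_wpM2r // (le_trans (norm_cosB1_le _)) // ger0_norm.
Qed.

Lemma pi_le4 : pi <= 4 :> R.
Proof. by have := @pihalf_02 R => /andP[_]; lra. Qed.

Lemma cabs_eB1_le x : cabs (e x - 1) <= 16 * `|x|.
Proof.
apply: le_trans (cabs_le_ReIm _) _; rewrite /= oppr0 addr0.
have := norm_cosB1_le (2 * pi * x); have := norm_sin_le (2 * pi * x).
rewrite !normrM (ger0_norm (pi_ge0 R)) ger0_norm //.
have := pi_le4; have := pi_ge0 R; have := normr_ge0 x; nra.
Qed.

Lemma cabs_eB_le x y : cabs (e x - e y) <= 16 * `|x - y|.
Proof.
rewrite -{1}[x](subrK y) eD -{2}[e y]mul1r -mulrBl normcM cabs_e mulr1.
exact: cabs_eB1_le.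
Qed.

Lemma cabs_eB1_lin x : cabs (e x - 1 - (0 +i* (2 * pi * x))) <= 128 * x ^+ 2.
Proof.
apply: le_trans (cabs_le_ReIm _) _; rewrite /= oppr0 !addr0.
have := norm_cosB1_le_sqr (2 * pi * x); have := norm_sinB_le_sqr (2 * pi * x).
have h : (2 * pi * x) ^+ 2 <= 64 * x ^+ 2.
  rewrite exprMn ler_wpM2r ?sqr_ge0 //; have := pi_le4; have := pi_ge0 R; nra.
rewrite /=; lra.
Qed.

Lemma cabs_eB1E x : cabs (e x - 1) = 2 * `|sin (pi * x)|.
Proof.
rewrite /= oppr0 addr0; have -> : 2 * pi * x = (pi * x) *+ 2 by rewrite mulr_natl mulrnAl.
have -> : 2 * `|sin (pi * x)| = `|2 * sin (pi * x)| by rewrite normrM ger0_norm.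
rewrite -sqrtr_sqr; congr Num.sqrt.
rewrite cos_mulr2n sin_mulr2n; have := cos2sin2 (pi * x).
move: (cos _) (sin _) => c s hc.
transitivity ((c ^+ 2 *+ 2 - 2) ^+ 2 + 4 * c ^+ 2 * s ^+ 2); first by ring.
by rewrite hc; ring.
Qed.

(** With z = pi x / 2 the modulus is 4 sin z cos z, and on [0, 3 pi / 8] both cos z >= c and sin z
    >= c z hold for c = cos(3 pi / 8). The range 3/4 is needed because |t - m| / q can reach 1/2 +
    1/q when |m| <= q/2, which is at most 3/4 for q >= 4. *)
Lemma cabs_eB1_ge : exists2 c : R, 0 < c & forall x, `|x| <= 3 / 4 -> c * `|x| <= cabs (e x - 1).
Proof.
pose c : R := cos (3 * pi / 8).
have pi0 := pi_gt0 R.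
have c0 : 0 < c by apply: cos_gt0_pihalf; apply/andP; split; lra.
exists (c ^+ 2); first by rewrite exprn_gt0.
have cosge z : 0 <= z <= 3 * pi / 8 -> c <= cos z.
  by move=> z1; rewrite /c leNgt ltr_cos ?in_itv /=; lra.
move=> x; wlog x0 : x / 0 <= x.
  move=> H; have [/H//|/ltW x0 xl] := leP 0 x.
  have := H (- x); rewrite oppr_ge0 normrN => /(_ x0 xl).
  by rewrite !cabs_eB1E mulrN sinN normrN.
rewrite (ger0_norm x0) => x34; rewrite cabs_eB1E.
set z := pi * x / 2.
have z0 : 0 <= z <= 3 * pi / 8 by rewrite /z; nra.
have zl : c * z <= sin z.
  have /andP[z00 _] := z0.
  have [w] := @MVT_segment R sin cos 0 z z00 (fun z _ => is_derive_sin z)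
    (continuous_subspaceT (@continuous_sin R)).
  rewrite in_itv /= sin0 !subr0 => w0 ->; rewrite ler_wpM2r // cosge //; lra.
have -> : pi * x = z *+ 2 by rewrite -mulr_natr /z divfK.
rewrite sin_mulr2n -(mulr_natr (cos z * sin z) 2); have cz := cosge z z0.
have [z00 _] := andP z0.
have sz : 0 <= sin z by apply: le_trans zl; rewrite mulr_ge0 // ltW.
have cs : 0 <= cos z * sin z by rewrite mulr_ge0 // (le_trans (ltW c0)).
rewrite (ger0_norm (mulr_ge0 cs _)) //.
have h1 : c * (c * z) <= cos z * sin z.
  by apply: ler_pM => //; rewrite ?mulr_ge0 // ltW.
apply: (@le_trans _ _ (4 * (c * (c * z)))); last by move: h1; lra.
have -> : 4 * (c * (c * z)) = c ^+ 2 * x * (2 * pi) by rewrite /z; field.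
by rewrite ler_peMr ?mulr_ge0 ?sqr_ge0 //; have := pi_ge2 R; lra.
Qed.

End TrigonometricEstimates.

(** * Symmetric sums and kernels *)

Definition symsum (V : nmodType) (f : int -> V) (M : nat) : V :=
  \sum_(j < M.*2.+1) f (j%:Z - M%:Z).

(** Zeroing the inner terms rather than cutting the range keeps every tail a [symsum]. *)
Definition outside (V : nmodType) (M : nat) (f : int -> V) (m : int) : V :=
  if (absz m <= M)%N then 0 else f m.

Section SymmetricSums.
Variable V : nmodType.
Implicit Types f g : int -> V.

Lemma symsumE f M : symsum f M = f 0 + \sum_(1 <= m < M.+1) (f m%:Z + f (- m%:Z)).
Proof.
elim: M => [|M IH]; first by rewrite /symsum big_ord1 big_geq ?addr0.
rewrite big_nat_recr //= addrA -IH /symsum doubleS big_ord_recl big_ord_recr /=.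
rewrite addrC -addrA; congr (_ + _).
  by apply: eq_bigr => j _; congr f; rewrite /= /bump /=; lia.
by congr (f _ + f _); rewrite /= ?/bump /=; lia.
Qed.

Lemma eq_symsum f g M : (forall m, (absz m <= M)%N -> f m = g m) -> symsum f M = symsum g M.
Proof. by move=> fg; apply: eq_bigr => j _; apply: fg; have := ltn_ord j; lia. Qed.

Lemma symsum_outside f M N : (M <= N)%N ->
  symsum f N = symsum f M + symsum (outside M f) N.
Proof.
move=> MN; rewrite !symsumE /= /outside leq0n add0r -addrA; congr (_ + _).
have MN1 : (M.+1 <= N.+1)%N by [].
rewrite (big_cat_nat _ MN1) //=; congr (_ + _).
rewrite [RHS](big_cat_nat _ MN1) //= [X in _ = X + _]big_nat [X in _ = X + _]big1 ?add0r.
  by apply: eq_big_nat => m mM; rewrite !ifN // ?abszN; lia.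
by move=> m mM; rewrite !ifT ?addr0 // ?abszN; lia.
Qed.

End SymmetricSums.

Lemma cabs_symsum (R : realType) (f : int -> R[i]) M :
  cabs (symsum f M) <= symsum (fun m => cabs (f m)) M.
Proof. exact: cabs_sum. Qed.

Lemma ler_symsum (R : numDomainType) (f g : int -> R) M :
  (forall m, (absz m <= M)%N -> f m <= g m) -> symsum f M <= symsum g M.
Proof. by move=> fg; apply: ler_sum => j _; apply: fg; have := ltn_ord j; lia. Qed.

(** Telescoping 1/(m(m-1)) = 1/(m-1) - 1/m, once for each sign of m. *)
Lemma symsum_outside_inv_le (R : realFieldType) (M N : nat) : (0 < M)%N ->
  symsum (outside M (fun m => ((absz m)%:R * ((absz m)%:R - 1))^-1)) N <= 2 / M%:R :> R.
Proof.
move=> M0; have [NM|MN] := leqP N M.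
  rewrite /symsum big1 ?divr_ge0 // => j _; rewrite /outside ifT //.
  by have := ltn_ord j; lia.
rewrite symsumE {1}/outside leq0n add0r.
have MN1 : (M.+1 <= N.+1)%N by exact: ltnW.
rewrite (big_cat_nat _ MN1) //= [X in X + _]big_nat [X in X + _]big1 ?add0r; last first.
  by move=> m mM; rewrite /outside !ifT ?addr0 // ?abszN; lia.
pose g (m : nat) : R := - 2 * (m.-1)%:R^-1.
rewrite [leLHS](_ : _ = \sum_(M.+1 <= m < N.+1) (g m.+1 - g m)).
  rewrite telescope_sumr ?ltnS ?(ltnW MN) // /g /= !mulNr opprK gerDr.
  by rewrite oppr_le0 mulr_ge0 ?invr_ge0.
apply: eq_big_nat => -[//|m] mM.
rewrite /outside abszN /= ifN -?ltnNge; last by lia.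
rewrite /g /= -natr1 addrK.
have m0 : m%:R != 0 :> R by rewrite pnatr_eq0; lia.
have m1 : m%:R + 1 != 0 :> R by rewrite natr1 pnatr_eq0.
by field; rewrite m0 m1.
Qed.

(** * The Dirichlet kernel and its continuous limit *)

Section Kernels.
Variable R : realType.
Implicit Types (t u : R) (m : int).

(** The integral of e(us) over s in [0,1], of which [dirichlet q u] is a Riemann sum. *)
Definition ekernel u : R[i] :=
  if u == 0 then 1 else (e u - 1) / (0 +i* (2 * pi * u)).

Lemma e_int m : e (m%:~R : R) = 1.
Proof.
case: m => n; first by rewrite -pmulrn e_nat.
by rewrite NegzE mulrNz eN -pmulrn e_nat invr1.
Qed.

Lemma imag_neq0 u : u != 0 -> (0 +i* (2 * pi * u) : R[i]) != 0.
Proof.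
move=> u0; rewrite eq_complex /= negb_and; apply/orP; right.
by rewrite !mulf_neq0 // gt_eqF // pi_gt0.
Qed.

Lemma GX_coefE m t : GX_coef m t = - ekernel (t - m%:~R).
Proof.
rewrite /GX_coef /ekernel subr_eq0; case: eqP => [//|/eqP tm].
rewrite eD eN e_int invr1 mulr1 -mulrN -invrN; congr (_ / _).
by rewrite -[m%:~R - t]opprB mulrN; simpc.
Qed.

Lemma dirichlet_geom (q : nat) u : (0 < q)%N ->
  dirichlet q u * (q%:R * (e (u / q%:R) - 1)) = e u - 1.
Proof.
move=> q0; have qn : q%:R != 0 :> R[i] by rewrite pnatr_eq0 -lt0n.
have qr : q%:R != 0 :> R by rewrite pnatr_eq0 -lt0n.
rewrite /dirichlet mulrCA !mulrA divff // mul1r mulrC.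
have -> : \sum_(n < q) e (u * n%:R / q%:R) = \sum_(n < q) e (u / q%:R) ^+ n.
  by apply: eq_bigr => n _; rewrite -eX; congr e; ring.
by rewrite -subrX1 -eX mulrC divfK.
Qed.

Lemma cabs_dirichlet_le1 (q : nat) u : (0 < q)%N -> cabs (dirichlet q u) <= 1.
Proof.
move=> q0; rewrite /dirichlet normcM normcV cabs_nat mulrC ler_pdivrMr ?ltr0n // mul1r.
apply: le_trans (cabs_sum _ _ _) _.
by under eq_bigr do rewrite cabs_e; rewrite sumr_const card_ord.
Qed.

(** Summing the geometric series expresses the difference through e(u/q) - 1 - 2 pi i u/q, the
    second-order error of the exponential. The growth in |u| is harmless, as m stays bounded
    whenever this is used. *)
Lemma ekernel_dirichlet (q : nat) u : (0 < q)%N ->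
  cabs (ekernel u - dirichlet q u) <= 128 * `|u| / q%:R.
Proof.
move=> q0; have qn : q%:R != 0 :> R[i] by rewrite pnatr_eq0 -lt0n.
have qr : q%:R != 0 :> R by rewrite pnatr_eq0 -lt0n.
rewrite /ekernel; have [->|u0] := eqVneq u 0.
  rewrite /dirichlet; under eq_bigr do rewrite !mul0r e0.
  by rewrite sumr_const card_ord mulVf // subrr normc0 normr0 mulr0 mul0r.
have iu := imag_neq0 u0.
have nu : 0 < `|u| by rewrite normr_gt0.
set d := dirichlet q u; set w : R[i] := 0 +i* (2 * pi * u).
have E : (e u - 1) / w - d =
    d * (q%:R * (e (u / q%:R) - 1 - (0 +i* (2 * pi * (u / q%:R))))) / w.
  apply: (mulIf iu); rewrite mulrBl !divfK //.
  rewrite [in RHS]mulrBr mulrBr dirichlet_geom //; congr (_ - d * _).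
  by rewrite complex_natr /w; simpc; congr (_ +i* _); field.
have h1 : cabs d <= 1 by exact: cabs_dirichlet_le1.
clearbody d; rewrite E normcM normcV cabs_imag !normcM cabs_nat.
rewrite ler_pdivrMr; last by rewrite normr_gt0 !mulf_neq0 // gt_eqF // pi_gt0.
have h2 := cabs_eB1_lin (u / q%:R).
have h3 : q%:R * cabs (e (u / q%:R) - 1 - (0 +i* (2 * pi * (u / q%:R))))
    <= 128 * `|u| / q%:R * `|u|.
  have -> : 128 * `|u| / q%:R * `|u| = q%:R * (128 * (u / q%:R) ^+ 2).
    by rewrite -[(_ / _) ^+ 2]real_normK ?num_real // normrM normfV normr_nat; field.
  by rewrite ler_wpM2l.
apply: le_trans (_ : 128 * `|u| / q%:R * `|u| <= _).
  by apply: le_trans h3; apply: ler_piMl; [rewrite mulr_ge0 // cabs_ge0 | exact: h1].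
rewrite !normrM ler_wpM2l ?mulr_ge0 ?invr_ge0 //.
rewrite ler_peMl // ger0_norm // (ger0_norm (pi_ge0 R)); have := pi_ge2 R; lra.
Qed.

Lemma addchar_neq1 (p : nat) (p_pr : prime p) (x : 'F_p) : x != 0 -> @addchar R p x != 1.
Proof.
move=> x0; have p0 : 0 < p%:R :> R by rewrite ltr0n prime_gt0.
have [c c0 cP] := cabs_eB1_ge R.
have ne1 u : u != 0 -> `|u| <= 3 / 4 -> e u != 1.
  move=> u0 /cP; apply: contraTneq => ->; rewrite subrr normc0 -ltNge.
  by rewrite mulr_gt0 // normr_gt0.
have v0 : 0 < (val x)%:R / p%:R :> R by rewrite divr_gt0 // ltr0n lt0n.
have v1 : (val x)%:R / p%:R < 1 :> R.
  by rewrite ltr_pdivrMr // mul1r ltr_nat (leq_trans (ltn_ord x)) // Fp_cast.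
rewrite /addchar; set v := _ / _ in v0 v1 *.
(* Beyond 3/4, subtract 1: by periodicity v may be replaced by a number in (-1/4, 0). *)
have [v34|v34] := leP v (3 / 4); first by rewrite ne1 ?gt_eqF // gtr0_norm.
rewrite -[v](subrK 1) eD e1 mulr1 ne1 //; first by rewrite subr_eq0 lt_eqF.
rewrite ltr0_norm; lra.
Qed.

End Kernels.

(** * Factorization of the tails *)

Section Tails.
Variable R : realType.
Implicit Types (t u : R) (m : int).

Lemma norm_intr_absz m : `|m%:~R : R| = (absz m)%:R.
Proof. by rewrite -intr_norm -abszE pmulrn. Qed.

Lemma cabs_eB1_le2 t : cabs (e t - 1) <= 2.
Proof. by apply: le_trans (cabs_sub_le _ _) _; rewrite cabs_e normc1; lra. Qed.

Lemma absz_real_ge2 m : (2 <= absz m)%N -> 2 <= (absz m)%:R :> R.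
Proof. by rewrite (ler_nat R 2). Qed.

Lemma dist_int_bounds m t : 0 <= t <= 1 -> (2 <= absz m)%N ->
  (absz m)%:R - 1 <= `|t - m%:~R| <= (absz m)%:R + 1.
Proof.
move=> /andP[t0 t1] m2; rewrite -norm_intr_absz.
have nt : `|t| <= 1 by rewrite ger0_norm.
have := ler_normB t (m%:~R); have := lerB_dist (m%:~R) t; rewrite distrC.
by move=> h1 h2; apply/andP; split; lra.
Qed.

(* The coefficient of the kernel with its denominator frozen at t = 0. *)
Definition dirichlet0 (q : nat) m : R[i] := (q%:R * (e (- (m%:~R / q%:R)) - 1))^-1.

(** Since e(t - m) = e(t), only the denominators q (e((t-m)/q) - 1) mix t and m. Freezing t = 0
    changes e((t-m)/q) by at most 16/q, while the two denominators are at least c(|m| - 1) and c|m|;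
    with |e(t) - 1| <= 2 this gives 32/c^2. The summand 1/c serves the second bound. *)
Lemma dirichlet_tail : exists2 C : R, 0 < C & forall (q : nat) m t,
  (4 <= q)%N -> (2 <= absz m)%N -> (2 * absz m <= q)%N -> 0 <= t <= 1 ->
  cabs (dirichlet q (t - m%:~R) - (e t - 1) * dirichlet0 q m)
      <= C / ((absz m)%:R * ((absz m)%:R - 1))
  /\ cabs (dirichlet0 q m) <= C / (absz m)%:R.
Proof.
have [c c0 cP] := cabs_eB1_ge R.
exists (32 / c ^+ 2 + c^-1) => [|q m t q4 m2 mq t01].
  by rewrite addr_gt0 ?divr_gt0 ?exprn_gt0 ?invr_gt0.
have q0 : 0 < q%:R :> R by rewrite ltr0n; lia.
have q4' : 4 <= q%:R :> R by rewrite (ler_nat R 4).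
have qn : (0 < q)%N by lia.
have qc : q%:R != 0 :> R[i] by rewrite pnatr_eq0 -lt0n.
have a2 := absz_real_ge2 m2; have am := norm_intr_absz m.
have aq : 2 * (absz m)%:R <= q%:R :> R by rewrite -natrM ler_nat.
have /andP[u1 u2] := dist_int_bounds t01 m2.
set a : R := (absz m)%:R in a2 am aq u1 u2 *.
set u := t - m%:~R in u1 u2 *.
set al := e (u / q%:R) - 1; set be := e (- (m%:~R / q%:R : R)) - 1.
have nuq (x : R) : `|x / q%:R| = `|x| / q%:R by rewrite normrM normfV normr_nat.
have hal : c * (`|u| / q%:R) <= cabs al.
  by rewrite -nuq; apply: cP; rewrite nuq ler_pdivrMr //; lra.
have hbe : c * (a / q%:R) <= cabs be.
  by rewrite -am -nuq -normrN; apply: cP; rewrite normrN nuq am ler_pdivrMr //; lra.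
have hal0 : 0 < cabs al by apply: lt_le_trans hal; rewrite mulr_gt0 // divr_gt0 //; lra.
have hbe0 : 0 < cabs be by apply: lt_le_trans hbe; rewrite mulr_gt0 // divr_gt0 //; lra.
have al0 : al != 0 by apply: contraTneq hal0 => ->; rewrite normc0 ltxx.
have be0 : be != 0 by apply: contraTneq hbe0 => ->; rewrite normc0 ltxx.
have c2 : 0 < c ^+ 2 by rewrite exprn_gt0.
have cc : 0 < c^-1 by rewrite invr_gt0.
have c32 : 0 < 32 / c ^+ 2 by rewrite divr_gt0.
split; last first.
  rewrite /dirichlet0 -/be normcV normcM cabs_nat -[leRHS]invrK invf_div lef_pV2 ?posrE.
  - apply: le_trans (_ : a / c^-1 <= _).
      by rewrite ler_pM2l ?lef_pV2 ?posrE ?addr_gt0 //; lra.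
    have -> : a / c^-1 = q%:R * (c * (a / q%:R)) by field; rewrite !gt_eqF.
    by rewrite ler_pM2l.
  - by rewrite mulr_gt0.
  - by rewrite divr_gt0 ?addr_gt0 //; lra.
have -> : dirichlet q u = (e t - 1) / (q%:R * al).
  have -> : e t = e u by rewrite /u eD eN e_int invr1 mulr1.
  by rewrite -(dirichlet_geom u qn) mulfK // mulf_neq0.
have -> : (e t - 1) / (q%:R * al) - (e t - 1) * dirichlet0 q m
    = (e t - 1) * (be - al) / (q%:R * al * be).
  by rewrite /dirichlet0 -/be; field; rewrite qc al0 be0.
rewrite normcM normcV !normcM cabs_nat ler_pdivrMr ?mulr_gt0 //.
have hba : cabs (be - al) <= 16 / q%:R.
  have -> : be - al = e (- (m%:~R / q%:R : R)) - e (u / q%:R).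
    by rewrite /be /al opprB addrA subrK.
  apply: le_trans (cabs_eB_le _ _) _; rewrite ler_wpM2l //.
  have -> : - (m%:~R / q%:R) - u / q%:R = - (t / q%:R) :> R by rewrite /u; ring.
  rewrite normrN nuq ger0_norm; last by case/andP: t01.
  by apply: ler_piMl; [rewrite invr_ge0 ltW|case/andP: t01].
apply: le_trans (_ : 2 * (16 / q%:R) <= _).
  by apply: ler_pM => //; [exact: cabs_ge0|exact: cabs_ge0|exact: cabs_eB1_le2].
apply: le_trans (_ : 32 / c ^+ 2 / (a * (a - 1)) * (q%:R * (c * ((a - 1) / q%:R)) * (c * (a / q%:R))) <= _).
  rewrite le_eqVlt; apply/orP; left; apply/eqP; field.
  by rewrite !gt_eqF //; lra.
have a1 : 0 <= a - 1 by lra.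
have a00 : 0 <= a by lra.
have [qw cw] : 0 <= q%:R :> R /\ 0 <= c by split; exact: ltW.
have aa : 0 < a * (a - 1) by rewrite mulr_gt0 //; lra.
apply: ler_pM.
- by rewrite divr_ge0 // ltW.
- by rewrite ?mulr_ge0 ?divr_ge0 ?invr_ge0.
- by apply: ler_wpM2r; [rewrite invr_ge0 ltW|rewrite lerDl ltW].
apply: ler_pM => //.
- by rewrite ?mulr_ge0 ?divr_ge0 ?invr_ge0.
- by rewrite ?mulr_ge0 ?divr_ge0 ?invr_ge0.
rewrite ler_pM2l //; apply: le_trans hal.
by rewrite ler_pM2l //; apply: ler_wpM2r; rewrite ?invr_ge0.
Qed.

Definition GX0 m : R[i] := (0 +i* (2 * pi * m%:~R))^-1.

(** The limit analogue of [dirichlet_tail]: 1/(m-t) - 1/m = t/(m(m-t)). *)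
Lemma GX_coef_tail m t : (2 <= absz m)%N -> 0 <= t <= 1 ->
  cabs (GX_coef m t - (e t - 1) * GX0 m) <= ((absz m)%:R * ((absz m)%:R - 1))^-1.
Proof.
move=> m2 t01; have a2 := absz_real_ge2 m2; have am := norm_intr_absz m.
have /andP[u1 _] := dist_int_bounds t01 m2.
set a : R := (absz m)%:R in a2 am u1 *.
have u0 : 0 < `|t - m%:~R| by lra.
have tm : t - m%:~R != 0 by rewrite -normr_gt0.
have m0 : m%:~R != 0 :> R by rewrite -normr_gt0 am; lra.
rewrite /GX_coef -subr_eq0 (negbTE tm) /GX0 -[m%:~R - t]opprB.
have -> : (e t - 1) / (0 +i* (2 * pi * - (t - m%:~R))) - (e t - 1) / (0 +i* (2 * pi * m%:~R))
  = (e t - 1) * (0 +i* (2 * pi * t)) / ((0 +i* (2 * pi * - (t - m%:~R))) * (0 +i* (2 * pi * m%:~R))).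
  have i1 := imag_neq0 m0.
  have i2 : (0 +i* (2 * pi * - (t - m%:~R)) : R[i]) != 0 by apply: imag_neq0; rewrite oppr_eq0.
  have -> : (0 +i* (2 * pi * t) : R[i]) = (0 +i* (2 * pi * m%:~R)) - (0 +i* (2 * pi * - (t - m%:~R))).
    by simpc; congr (_ +i* _); ring.
  by field; rewrite i1 i2.
rewrite normcM normcV !normcM !cabs_imag !normrM normrN am.
have pi0 := pi_gt0 R; rewrite (ger0_norm (ltW pi0)) ger0_norm //.
have -> : `|t| = t by rewrite ger0_norm //; case/andP: t01.
have /andP[t0 t1] := t01; have e2 := cabs_eB1_le2 t; have pi2 := pi_ge2 R.
have d0 : 0 < 2 * pi * `|t - m%:~R| * (2 * pi * a).
  by rewrite !mulr_gt0 //; lra.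
have a1 : 0 < a * (a - 1) by rewrite mulr_gt0 //; lra.
rewrite ler_pdivrMr // [leRHS]mulrC ler_pdivlMr //.
have h1 : cabs (e t - 1) * (2 * pi * t) <= 2 * (2 * pi).
  have tp : 0 <= 2 * pi :> R by rewrite mulr_ge0 // ltW.
  by apply: ler_pM => //; [exact: cabs_ge0|exact: mulr_ge0|exact: ler_piMr].
apply: le_trans (_ : 2 * (2 * pi) * (a * (a - 1)) <= _).
  by rewrite ler_wpM2r // ltW.
have -> : 2 * pi * `|t - m%:~R| * (2 * pi * a) = 2 * (2 * pi) * (pi * (a * `|t - m%:~R|)) by ring.
rewrite ler_pM2l ?mulr_gt0 //; apply: le_trans (_ : a * `|t - m%:~R| <= _).
  by rewrite ler_wpM2l //; lra.
by rewrite ler_peMl ?mulr_ge0 //; lra.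
Qed.

(** On the right-hand side t no longer occurs. The factor 2 bounds |e(t) - 1|, and 2C/M sums the
    freezing errors over both signs of m. *)
Lemma tail_bound (K : int -> R -> R[i]) (k0 : int -> R[i]) (C : R) (M N : nat)
    (x : int -> R) t : 0 <= C -> (0 < M)%N ->
  (forall m, (M < absz m <= N)%N ->
     cabs (K m t - (e t - 1) * k0 m) <= C / ((absz m)%:R * ((absz m)%:R - 1))) ->
  (forall m, `|x m| <= 1) ->
  cabs (symsum (outside M (fun m => K m t * (x m)%:C)) N)
    <= 2 * cabs (symsum (outside M (fun m => k0 m * (x m)%:C)) N) + 2 * C / M%:R.
Proof.
move=> C0 M0 Kk x1.
have -> : symsum (outside M (fun m => K m t * (x m)%:C)) N =
   (e t - 1) * symsum (outside M (fun m => k0 m * (x m)%:C)) N +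
   symsum (outside M (fun m => (K m t - (e t - 1) * k0 m) * (x m)%:C)) N.
  rewrite /symsum mulr_sumr -big_split; apply: eq_bigr => j _; rewrite /outside /=.
  by case: ifP => _; [rewrite mulr0 addr0|ring].
apply: le_trans (cabs_le_add _ _) _; apply: lerD.
  by rewrite normcM ler_wpM2r ?cabs_ge0 // cabs_eB1_le2.
apply: le_trans (cabs_symsum _ _) _.
apply: le_trans (_ : C * symsum (outside M (fun m => ((absz m)%:R * ((absz m)%:R - 1))^-1)) N <= _).
  rewrite /symsum mulr_sumr; apply: (ler_symsum (f := fun m => cabs (outside _ _ m))
    (g := fun m => C * outside _ _ m)) => m mN.
  rewrite /outside; case: leqP => mM; first by rewrite normc0 mulr0.
  rewrite normcM cabs_real; apply: le_trans (Kk m _); last by rewrite mM.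
  by apply: ler_piMr; [exact: cabs_ge0|exact: x1].
by rewrite [2 * C]mulrC -mulrA ler_wpM2l // symsum_outside_inv_le.
Qed.

End Tails.

(** * Averages over the residues modulo p *)

Section FeketeSide.
Variable R : realType.
Implicit Types (m : int) (M k p : nat).

Definition chi_shift p k m : R := (qchar (k%:R + m%:~R : 'F_p))%:~R.

Lemma norm_qchar_le1 (F : finFieldType) (a : F) : `|qchar a| <= 1.
Proof. by rewrite /qchar; case: eqP => _; case: eqP. Qed.

Lemma norm_chi_shift_le1 p k m : `|chi_shift p k m| <= 1.
Proof. by rewrite /chi_shift -intr_norm (ler_int R _ 1) norm_qchar_le1. Qed.

Lemma Gp_symsum p k (t : I01 R) : prime p -> odd p ->
  Gp_fun p k t = symsum (fun m => dirichlet p (val t - m%:~R) * (chi_shift p k m)%:C) p./2.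
Proof.
move=> p_pr p_odd; rewrite Gp_funE //; last exact: addchar_neq1.
pose f (j : nat) : R[i] := dirichlet p (val t - (j%:Z - (p./2)%:Z)%:~R)
  * (chi_shift p k (j%:Z - (p./2)%:Z))%:C.
transitivity (\sum_(j < p) f j).
  by apply: eq_bigr => j _; rewrite /f mulrC /chi_shift rmorph_int.
have pE : p = (p./2).*2.+1 by rewrite -[LHS]odd_double_half p_odd.
rewrite /symsum -(big_mkord xpredT f) -(big_mkord xpredT f).
by congr (\sum_(0 <= _ < _) _).
Qed.

Lemma shift_Fp_inj p n M : prime p -> (n <= p)%N ->
  injective (fun j : 'I_n => (j%:Z - M%:Z)%:~R : 'F_p).
Proof.
move=> p_pr np i j /eqP; rewrite !rmorphB /= (inj_eq (addIr _)) -!pmulrn => /eqP.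
move=> /(congr1 (@nat_of_ord _)); rewrite !val_Fp_nat // !modn_small => [/val_inj//||];
exact: leq_trans np.
Qed.

(** The square subtracted in [sum_qchar_lin_sqr] is dropped. *)
Lemma chi_shift_second_moment p M (b : int -> R) : prime p -> odd p ->
  \sum_(k < p) symsum (outside M (fun m => b m * chi_shift p k m)) p./2 ^+ 2
    <= p%:R * symsum (outside M (fun m => b m ^+ 2)) p./2.
Proof.
move=> p_pr p_odd; set h := p./2.
have pE : p = h.*2.+1 by rewrite -[LHS]odd_double_half p_odd.
pose sh (j : 'I_h.*2.+1) : 'F_p := (j%:Z - h%:Z)%:~R.
have sh_inj : injective sh by apply: shift_Fp_inj => //; rewrite -pE.
have oE k (j : 'I_h.*2.+1) : outside M (fun m => b m * chi_shift p k m) (j%:Z - h%:Z)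
   = outside M b (j%:Z - h%:Z) * (qchar (k%:R + sh j))%:~R.
  by rewrite /outside /chi_shift; case: ifP => _; rewrite ?mul0r.
pose f k : R := (\sum_(j < h.*2.+1) outside M b (j%:Z - h%:Z) * (qchar (k%:R + sh j))%:~R) ^+ 2.
rewrite (eq_bigr (fun k : 'I_p => f k)); last first.
  by move=> k _; rewrite /f /symsum; congr (_ ^+ 2); apply: eq_bigr => j _; exact: oE.
rewrite -sum_Fp // /f.
under eq_bigr do rewrite natr_Zp.
rewrite (sum_qchar_lin_sqr p_pr p_odd (card_Fp p_pr) _ sh_inj) lerBlDr.
apply: ler_wpDr; first exact: sqr_ge0.
rewrite ler_wpM2l // /symsum le_eqVlt; apply/orP; left; apply/eqP.
by apply: eq_bigr => j _; rewrite /outside; case: ifP => _; rewrite ?expr0n.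
Qed.

Lemma norm_le_AMGM (x d : R) : 0 < d -> `|x| <= (d + x ^+ 2 / d) / 2.
Proof.
move=> d0; have E : d + x ^+ 2 / d = (d ^+ 2 + `|x| ^+ 2) / d.
  by rewrite real_normK ?num_real //; field; rewrite gt_eqF.
rewrite E -mulrA -invfM ler_pdivlMr ?mulr_gt0 //.
by have := sqr_ge0 (d - `|x|); nra.
Qed.

(** The first moment comes from the second by the inequality of arithmetic and geometric means, with
    d left free to be small before M is taken large. Real and imaginary parts are separated because
    the second moment is for real coefficients. *)
Lemma chi_shift_mean_tail p M (k0 : int -> R[i]) (C d : R) : prime p -> odd p ->
  (0 < M)%N -> 0 <= C -> 0 < d ->
  (forall m, (M < absz m <= p./2)%N -> cabs (k0 m) <= C / (absz m)%:R) ->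
  \sum_(k < p) cabs (symsum (outside M (fun m => k0 m * (chi_shift p k m)%:C)) p./2)
    <= p%:R * (d + 2 * C ^+ 2 / (M%:R * d)).
Proof.
move=> p_pr p_odd M0 C0 d0 k0C.
have M0' : 0 < M%:R :> R by rewrite ltr0n.
pose re m := complex.Re (k0 m); pose im m := complex.Im (k0 m).
pose S (b : int -> R) k := symsum (outside M (fun m => b m * chi_shift p k m)) p./2.
have part (b : int -> R) : (forall m, `|b m| <= cabs (k0 m)) ->
    \sum_(k < p) `|S b k| <= p%:R * ((d + 2 * C ^+ 2 / (M%:R * d)) / 2).
  move=> bk; apply: le_trans (ler_sum _ (fun (k : 'I_p) _ => norm_le_AMGM (S b k) d0)) _.
  rewrite -mulr_suml big_split /= sumr_const card_ord -mulr_suml mulrA.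
  apply: ler_wpM2r; first by rewrite invr_ge0.
  rewrite -(mulr_natl d p) mulrDr; apply: lerD => //.
  rewrite ler_pdivrMr // -mulrA invfM -!mulrA mulVf ?gt_eqF // mulr1.
  apply: le_trans (chi_shift_second_moment M b p_pr p_odd) _.
  rewrite ler_wpM2l //.
  apply: (@le_trans _ _ (C ^+ 2 * symsum (outside M
      (fun m => ((absz m)%:R * ((absz m)%:R - 1))^-1)) p./2)); last first.
    have -> : 2 * (C * (C / M%:R)) = C ^+ 2 * (2 / M%:R) by ring.
    by rewrite ler_wpM2l ?sqr_ge0 // symsum_outside_inv_le.
  rewrite /symsum mulr_sumr; apply: (ler_symsum (f := fun m => outside _ _ m)
    (g := fun m => C ^+ 2 * outside _ _ m)) => m mh.
  rewrite /outside; case: leqP => mM; first by rewrite mulr0.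
  have a1 : 2 <= (absz m)%:R :> R by rewrite (ler_nat R 2); lia.
  apply: (@le_trans _ _ ((C / (absz m)%:R) ^+ 2)).
    rewrite -[b m ^+ 2]real_normK ?num_real // lerXn2r ?nnegrE ?divr_ge0 //.
    by apply: le_trans (bk m) _; apply: k0C; rewrite mM.
  rewrite exprMn ler_wpM2l ?sqr_ge0 // exprVn lef_pV2 ?posrE; first by nra.
    by rewrite exprn_gt0; lra.
  by rewrite mulr_gt0; lra.
apply: (@le_trans _ _ (\sum_(k < p) (`|S re k| + `|S im k|))).
  apply: ler_sum => k _; apply: le_trans (cabs_le_ReIm _) _.
  set T := symsum _ _.
  have -> : complex.Re T = S re k.
    rewrite /T /S /symsum (raddf_sum (@complex.Re R)); apply: eq_bigr => j _.
    by rewrite /outside /re; case: ifP => _ //; case: (k0 _) => a b /=; ring.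
  have -> : complex.Im T = S im k => //.
  rewrite /T /S /symsum (raddf_sum (@complex.Im R)); apply: eq_bigr => j _.
  by rewrite /outside /im; case: ifP => _ //; case: (k0 _) => a b /=; ring.
rewrite big_split /= [leRHS](_ : _ =
   p%:R * ((d + 2 * C ^+ 2 / (M%:R * d)) / 2) + p%:R * ((d + 2 * C ^+ 2 / (M%:R * d)) / 2)).
  by apply: lerD; apply: part => m; [exact: Re_le_cabs|exact: Im_le_cabs].
by rewrite -mulrDr -splitr.
Qed.

Lemma GX_partialE (x : int -> R) M t :
  GX_partial x M t = symsum (fun m => GX_coef m (val t) * (x m)%:C) M.
Proof. by []. Qed.

Lemma I01_itv (t : I01 R) : 0 <= val t <= 1.
Proof. by have := set_mem (valP t); rewrite /= in_itv. Qed.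

Lemma dist_int_le (m : int) (t : I01 R) : `|val t - m%:~R| <= (absz m)%:R + 1.
Proof.
apply: le_trans (ler_normB _ _) _; rewrite norm_intr_absz addrC lerD2l.
by have /andP[t0 t1] := I01_itv t; rewrite ger0_norm.
Qed.

(** The first error term replaces the Dirichlet kernel by its limit for |m| <= M; the other two
    bound the tail, and of the three only the middle one depends on k. The sign of [- chi_shift]
    cancels the one in [GX_coefE]. *)
Lemma Gp_close : exists2 C : R, 0 < C & forall p M, prime p -> (4 < p)%N ->
  (0 < M <= p./2)%N ->
  (forall m, (M < absz m <= p./2)%N -> cabs (dirichlet0 R p m) <= C / (absz m)%:R) /\
  forall k t, cabs (Gp_fun p k t - GX_partial (fun m => - chi_shift p k m) M t) <=
    C * (M.+1 * M.*2.+1)%:R / p%:R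
    + 2 * cabs (symsum (outside M (fun m => dirichlet0 R p m * (chi_shift p k m)%:C)) p./2)
    + 2 * C / M%:R.
Proof.
have [C0 C00 CP] := dirichlet_tail R; exists (C0 + 128) => [|p M p_pr p4 /andP[M0 Mh]].
  by rewrite addr_gt0.
have p_odd : odd p by case: (even_prime p_pr) => // p2; rewrite p2 in p4.
have C0C : C0 <= C0 + 128 by rewrite lerDl.
have tail m t : (M < absz m <= p./2)%N -> 0 <= t <= 1 ->
    cabs (dirichlet p (t - m%:~R) - (e t - 1) * dirichlet0 R p m)
      <= C0 / ((absz m)%:R * ((absz m)%:R - 1)) /\ cabs (dirichlet0 R p m) <= C0 / (absz m)%:R.
  by move=> mM t01; apply: CP => //; [lia..|move: mM (odd_double_half p); rewrite p_odd; lia].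
split=> [m mM|k t].
  have t01 : 0 <= (0 : R) <= 1 by rewrite lexx ler01.
  have [_ h] := tail m 0 mM t01.
  by apply: le_trans h _; rewrite ler_wpM2r ?invr_ge0.
rewrite Gp_symsum // GX_partialE (symsum_outside _ Mh) addrAC.
have M0' : 0 < M%:R :> R by rewrite ltr0n.
have p0 : 0 < p%:R :> R by rewrite ltr0n prime_gt0.
apply: le_trans (cabs_le_add _ _) _; rewrite -[leRHS]addrA; apply: lerD; last first.
  have tl m : (M < absz m <= p./2)%N -> cabs (dirichlet p (val t - m%:~R)
      - (e (val t) - 1) * dirichlet0 R p m) <= C0 / ((absz m)%:R * ((absz m)%:R - 1)).
    by move=> mM; have [] := tail m (val t) mM (I01_itv t).
  apply: le_trans (tail_bound (K := fun m t => dirichlet p (t - m%:~R))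
    (ltW C00) M0 tl (norm_chi_shift_le1 p k)) _.
  by rewrite lerD2l ler_pM2r ?invr_gt0 // ler_pM2l.
rewrite /symsum -sumrB; apply: le_trans (cabs_sum _ _ _) _.
apply: (@le_trans _ _ (\sum_(j < M.*2.+1) (C0 + 128) * M.+1%:R / p%:R)); last first.
  by rewrite sumr_const card_ord -mulr_natr natrM; lra.
apply: ler_sum => j _; set m := j%:Z - M%:Z.
have mM : (absz m <= M)%N by rewrite /m; have := ltn_ord j; lia.
rewrite GX_coefE rmorphN mulrNN -mulrBl normcM cabs_real.
apply: (@le_trans _ _ (cabs (dirichlet p (val t - m%:~R) - ekernel (val t - m%:~R)))).
  by apply: ler_piMr; [exact: cabs_ge0|exact: norm_chi_shift_le1].
rewrite cabs_distC; apply: le_trans (ekernel_dirichlet _ (prime_gt0 p_pr)) _.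
rewrite ler_pM2r ?invr_gt0 //; apply: ler_pM => //; first by rewrite lerDr ltW.
apply: le_trans (dist_int_le _ _) _; rewrite -natr1 lerD2r ler_nat //.
Qed.

(** M is fixed before p. The bound [r k] is uniform in t, but only its mean over k is small. *)
Lemma Gp_truncation (eps : R) : 0 < eps ->
  exists2 M0, (0 < M0)%N & forall M, (M0 <= M)%N -> exists p0, forall p, prime p -> (p0 <= p)%N ->
    exists2 r : nat -> R,
      (forall k t, cabs (Gp_fun p k t - GX_partial (fun m => - chi_shift p k m) M t) <= r k)
      & \sum_(k < p) r k <= p%:R * eps.
Proof.
move=> e0; have [C C0 CP] := Gp_close.
(* The mean of [r] is at most eps/4 + 2d + eps/4: [D] bounds p for the first term, and [B] bounds M
   for what remains of the tail. *)
pose d := eps / 8; have d0 : 0 < d by rewrite divr_gt0.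
pose B := (4 * C ^+ 2 / d + 2 * C) * 4 / eps.
have B0 : 0 < B by rewrite /B ?(mulr_gt0, addr_gt0, exprn_gt0, invr_gt0).
exists (Num.bound B).+1 => // M BM.
have M0 : (0 < M)%N by exact: leq_trans BM.
have M0' : 0 < M%:R :> R by rewrite ltr0n.
have hM : B <= M%:R.
  apply/ltW/(lt_trans (archi_boundP (ltW B0))).
  by rewrite ltr_nat.
pose D := C * (M.+1 * M.*2.+1)%:R * 4 / eps.
have D0 : 0 <= D by rewrite /D !mulr_ge0 ?invr_ge0 // ltW.
exists (Num.bound D + M.*2 + 5)%N => p p_pr pp.
have p4 : (4 < p)%N by lia.
have p_odd : odd p by case: (even_prime p_pr) => // p2; rewrite p2 in p4.
have Mh : (0 < M <= p./2)%N by rewrite M0 /=; lia.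
have p0 : 0 < p%:R :> R by rewrite ltr0n prime_gt0.
have [k0C H] := CP p M p_pr p4 Mh.
exists (fun k => C * (M.+1 * M.*2.+1)%:R / p%:R
    + 2 * cabs (symsum (outside M (fun m => dirichlet0 R p m * (chi_shift p k m)%:C)) p./2)
    + 2 * C / M%:R) => //.
have hp : D <= p%:R.
  by apply/ltW/(lt_le_trans (archi_boundP D0)); rewrite ler_nat; lia.
have sumc (c : R) : \sum_(k < p) c = p%:R * c by rewrite sumr_const card_ord mulr_natl.
rewrite 2!big_split /= 2!sumc -mulr_sumr.
have := chi_shift_mean_tail p_pr p_odd M0 (ltW C0) d0 k0C.
set S := \sum_(_ < _) _ => HS.
have h1 : C * (M.+1 * M.*2.+1)%:R / p%:R <= eps / 4.
  by rewrite ler_pdivrMr //; move: hp; rewrite /D ler_pdivrMr //; lra.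
have h2 : 4 * C ^+ 2 / (M%:R * d) + 2 * C / M%:R <= eps / 4.
  have -> : 4 * C ^+ 2 / (M%:R * d) + 2 * C / M%:R = (4 * C ^+ 2 / d + 2 * C) / M%:R.
    by field; rewrite !gt_eqF.
  by rewrite ler_pdivrMr //; move: hM; rewrite /B ler_pdivrMr //; lra.
apply: (@le_trans _ _ (p%:R * (eps / 4 + 2 * d + eps / 4))); last first.
  by rewrite ler_pM2l // /d; lra.
apply: (@le_trans _ _ (p%:R * (C * (M.+1 * M.*2.+1)%:R / p%:R)
   + 2 * (p%:R * (d + 2 * C ^+ 2 / (M%:R * d))) + p%:R * (2 * C / M%:R))).
  by rewrite lerD2r lerD2l ler_pM2l.
have -> : p%:R * (C * (M.+1 * M.*2.+1)%:R / p%:R)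
   + 2 * (p%:R * (d + 2 * C ^+ 2 / (M%:R * d))) + p%:R * (2 * C / M%:R)
  = p%:R * (C * (M.+1 * M.*2.+1)%:R / p%:R + 2 * d + (4 * C ^+ 2 / (M%:R * d) + 2 * C / M%:R)).
  by field; rewrite !gt_eqF.
by rewrite ler_pM2l // lerD // lerD2r.
Qed.

(** The order L depends on d and M alone: L >= (n+1)/d absorbs the main error (n+1)p, and p >= 8n/d
    absorbs 8Ln. *)
Lemma chi_shift_pattern_count M (d : R) : 0 < d -> exists p0, forall p, prime p -> (p0 <= p)%N ->
  forall e : 'I_M.*2.+1 -> bool,
  `|(#|[set x : 'F_p | [forall j : 'I_M.*2.+1,
        qchar (x + (j%:Z - M%:Z)%:~R) == (-1) ^+ e j]]%SET|)%:R - p%:R / (2 ^ M.*2.+1)%:R|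
    <= p%:R * d.
Proof.
move=> d0; set n := M.*2.+1.
have B1 : 0 <= n.+1%:R / d :> R by rewrite divr_ge0 // ltW.
have B2 : 0 <= 8 * n%:R / d :> R by rewrite !mulr_ge0 // invr_ge0 ltW.
pose L := (Num.bound (n.+1%:R / d)).+1.
exists (2 * L * (2 * L * n + L.+1) + n + 3 + Num.bound (8 * n%:R / d))%N => p p_pr pp e.
have p_odd : odd p by case: (even_prime p_pr) => // p2; move: pp; rewrite p2; lia.
have np : (n <= p)%N by lia.
have pL : (2 * L * (2 * L * #|'I_n| + L.+1) + #|'I_n| + 2 <= p)%N by rewrite card_ord; lia.
have := qchar_pattern_count p_pr p_odd (card_Fp p_pr) e (shift_Fp_inj (M := M) p_pr np) pL.
move=> H0; set N := #|_|.
have H : `|(2 ^ n)%:Z * N%:Z - p%:Z| * (2 * L)%:Z <= (2 ^ n * (n.+1 * p + 8 * L * n))%:Z.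
  by move: H0; rewrite card_ord.
move: N H => {H0} N H.
have p0 : 0 < p%:R :> R by rewrite ltr0n prime_gt0.
have t0 : 0 < (2 ^ n)%:R :> R by rewrite ltr0n expn_gt0.
have L0 : 0 < L%:R :> R by rewrite ltr0n.
have {}H : `|(2 ^ n)%:R * N%:R - p%:R| * (2 * L%:R) <= (2 ^ n)%:R * (n.+1%:R * p%:R + 8 * L%:R * n%:R) :> R.
  move: H; rewrite -(ler_int R) !rmorphM /= intr_norm rmorphB /= rmorphM /= -!pmulrn.
  by rewrite !natrM natrD !natrM.
have -> : N%:R - p%:R / (2 ^ n)%:R = ((2 ^ n)%:R * N%:R - p%:R) / (2 ^ n)%:R :> R.
  by field; rewrite gt_eqF.
rewrite normrM normfV [`|(2 ^ n)%:R|]ger0_norm ?(ltW t0) // ler_pdivrMr //.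
have L2 : 0 < 2 * L%:R :> R by rewrite mulr_gt0.
rewrite -(ler_pM2r L2); apply: le_trans H _.
have -> : p%:R * d * (2 ^ n)%:R * (2 * L%:R) = (2 ^ n)%:R * (p%:R * (d * L%:R) + L%:R * (p%:R * d)) by ring.
rewrite ler_pM2l //; apply: lerD.
  rewrite mulrC ler_pM2l // mulrC -ler_pdivrMr // ltW // (lt_trans (archi_boundP B1)) //.
  by rewrite ltr_nat.
rewrite [8 * _]mulrC -mulrA ler_pM2l // -ler_pdivrMr // ltW // (lt_le_trans (archi_boundP B2)) //.
by rewrite ler_nat; lia.
Qed.

(** If some k + m is 0 modulo p the symbols form no sign pattern, and [V k] is then controlled only
    by B. *)
Lemma sign_average M (G : {ffun 'I_M.*2.+1 -> bool} -> R) (B eps : R) :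
  0 < eps -> (forall f, `|G f| <= B) ->
  exists p0, forall p, prime p -> (p0 <= p)%N -> forall V : nat -> R,
    (forall k, `|V k| <= B) ->
    (forall k (f : {ffun 'I_M.*2.+1 -> bool}),
       (forall j : 'I_M.*2.+1, chi_shift p k (j%:Z - M%:Z) = (-1) ^+ f j) -> V k = G f) ->
    `|\sum_(k < p) V k - p%:R * ((2 ^ M.*2.+1)%:R^-1 * \sum_f G f)| <= p%:R * eps.
Proof.
move=> eps0 GB; set n := M.*2.+1; set T := (2 ^ n)%:R : R.
have t0 : 0 < T by rewrite ltr0n expn_gt0.
have B0 : 0 <= B by apply: le_trans (GB [ffun=> true]).
(* Two errors of size p d B T arise; [B + 1] keeps the divisor positive when B = 0. *)
pose d := eps / (2 * (B + 1) * T).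
have d0 : 0 < d by rewrite divr_gt0 // !mulr_gt0 // ltr_wpDl.
have [p0 H] := chi_shift_pattern_count M d0; exists p0 => p p_pr pp V VB VG.
have p0' : 0 < p%:R :> R by rewrite ltr0n prime_gt0.
pose pat (x : 'F_p) (f : {ffun 'I_n -> bool}) :=
  [forall j : 'I_n, qchar (x + (j%:Z - M%:Z)%:~R) == (-1) ^+ f j].
pose N f : R := (#|[set x | pat x f]%SET|)%:R.
have NE f : N f = \sum_x (pat x f)%:R.
  rewrite /N -sum1dep_card natr_sum big_mkcond /=.
  by apply: eq_bigr => x _; case: (pat x f).
have {}H f : `|N f - p%:R / T| <= p%:R * d by exact: H.
pose u x : R := \sum_f (pat x f)%:R.
have u1 x : u x <= 1.
  have [[f0 pf0]|nf] := pselect (exists f, pat x f).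
    rewrite /u (bigD1 f0) //= pf0 big1 ?addr0 // => f ff0.
    case: (boolP (pat x f)) => // /forallP pf; case/eqP: ff0; apply/ffunP => j.
    move/forallP: pf0 => /(_ j) /eqP; rewrite (eqP (pf j)).
    by case: (f j); case: (f0 j).
  by rewrite /u big1 // => f _; case: (boolP (pat x f)) => // pf; case: nf; exists f.
rewrite -(sum_Fp V) //.
have VE x f : pat x f -> V (val x) = G f.
  move=> /forallP pf; apply: VG => j; rewrite /chi_shift natr_Zp (eqP (pf j)).
  by rewrite rmorphXn rmorphN1.
(* The weight [1 - u x] singles out the x without a pattern. It sums to p minus all [N f], so the
   deviations of the pattern counts also bound the exceptional x. *)
have -> : \sum_(x : 'F_p) V (val x) = \sum_f N f * G f + \sum_(x : 'F_p) V (val x) * (1 - u x).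
  under [X in _ = X + _]eq_bigr do rewrite NE mulr_suml.
  rewrite exchange_big -big_split /=; apply: eq_bigr => x _.
  rewrite (eq_bigr (fun f => V (val x) * (pat x f)%:R)).
    by rewrite -mulr_sumr -/(u x); ring.
  by move=> f _; case: (boolP (pat x f)) => [/VE->|_]; rewrite ?mul0r ?mulr0 // mulrC.
rewrite addrAC; apply: le_trans (ler_normD _ _) _.
have cardT : \sum_(f : {ffun 'I_n -> bool}) 1 = T :> R.
  by rewrite sumr_const card_ffun card_bool card_ord.
have -> : p%:R * eps = p%:R * d * B * T + p%:R * d * T * B + 2 * p%:R * d * T.
  by rewrite /d; field; rewrite !gt_eqF //; lra.
have pd : 0 <= p%:R * d by rewrite mulr_ge0 // ltW.
have t0' := ltW t0.
rewrite -[leLHS]addr0; apply: lerD; last by rewrite -(mulrA 2) mulr_ge0 // mulr_ge0.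
apply: lerD.
  rewrite mulrA mulr_sumr -sumrB -[in leRHS]cardT mulr_sumr; apply: le_trans (ler_norm_sum _ _ _) _.
  apply: ler_sum => f _; rewrite mulr1 -mulrBl normrM.
  by apply: ler_pM.
apply: le_trans (ler_norm_sum _ _ _) _.
apply: (@le_trans _ _ (\sum_x B * (1 - u x))).
  apply: ler_sum => x _; rewrite normrM [`|1 - _|]ger0_norm ?subr_ge0 //.
  by rewrite ler_wpM2r // subr_ge0.
rewrite -mulr_sumr mulrC ler_wpM2r // sumrB sumr_const card_Fp // /u exchange_big /=.
have pE : p%:R = \sum_(f : {ffun 'I_n -> bool}) p%:R / T :> R.
  by under eq_bigr do rewrite -[_ / _]mulr1; rewrite -mulr_sumr cardT divfK // gt_eqF.
rewrite [X in X - _]pE.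
rewrite -sumrB -[in leRHS]cardT mulr_sumr; apply: ler_sum => f _; rewrite -NE mulr1.
by apply: le_trans (H f); rewrite distrC ler_norm.
Qed.

(* Negating all signs is a symmetry of the uniform distribution. *)
Lemma sign_averageN M (G : {ffun 'I_M.*2.+1 -> bool} -> R) (B eps : R) :
  0 < eps -> (forall f, `|G f| <= B) ->
  exists p0, forall p, prime p -> (p0 <= p)%N -> forall V : nat -> R,
    (forall k, `|V k| <= B) ->
    (forall k (f : {ffun 'I_M.*2.+1 -> bool}),
       (forall j : 'I_M.*2.+1, - chi_shift p k (j%:Z - M%:Z) = (-1) ^+ f j) -> V k = G f) ->
    `|\sum_(k < p) V k - p%:R * ((2 ^ M.*2.+1)%:R^-1 * \sum_f G f)| <= p%:R * eps.
Proof.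
move=> e0 GB; pose neg (f : {ffun 'I_M.*2.+1 -> bool}) := [ffun j => ~~ f j].
have negK : involutive neg by move=> f; apply/ffunP => j; rewrite !ffunE negbK.
have [p0 H] := sign_average e0 (fun f => GB (neg f)); exists p0 => p p_pr pp V VB VG.
rewrite (reindex_inj (inv_inj negK)); apply: H => // k f kf; apply: VG => j.
by rewrite kf ffunE; case: (f j); rewrite /= expr0 expr1 ?opprK.
Qed.

End FeketeSide.

(** * Uniform convergence of the sign series *)

Section UniformLimits.
Variable R : realType.

Lemma cvgn_eps (u : nat -> R) (l : R) :
  u @ \oo --> l <-> forall eps, 0 < eps -> exists M0, forall M, (M0 <= M)%N -> `|u M - l| <= eps.
Proof.
split=> [/cvgrPdist_le ul eps e0|H].
  by have [M0 _ h] := ul _ e0; exists M0 => M MM; rewrite distrC; exact: h.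
apply/cvgrPdist_le => eps e0; have [M0 h] := H _ e0.
by exists M0 => // M /= MM; rewrite distrC; exact: h.
Qed.

Lemma cauchy_cvgn (u : nat -> R) :
  (forall eps, 0 < eps -> exists M0, forall M, (M0 <= M)%N -> `|u M - u M0| <= eps) ->
  cvgn u.
Proof.
move=> H; apply/cauchy_cvgP/cauchy_exP => eps e0.
have [M0 h] := H _ (divr_gt0 e0 (ltr0n R 2)); exists (u M0).
exists M0 => // M /= MM; rewrite -ball_normE /ball_ /= distrC.
by apply: le_lt_trans (h M MM) _; rewrite ltr_pdivrMr // ltr_pMr // ltr1n.
Qed.

Lemma cvgn_complex (u : nat -> R[i]) (z : R[i]) :
  (forall eps, 0 < eps -> exists M0, forall M, (M0 <= M)%N -> cabs (z - u M) <= eps) ->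
  u @ \oo --> z.
Proof.
move=> H A /nbhs_complexP[eps e0 HA]; have [M0 h] := H _ (divr_gt0 e0 (ltr0n R 2)).
exists M0 => // M /= MM; apply: HA; apply: le_lt_trans (h M MM) _.
by rewrite ltr_pdivrMr // ltr_pMr // ltr1n.
Qed.

(** Completeness is used for real and imaginary parts separately, which accounts for the factor
    2. *)
Lemma cauchy_complex (u : nat -> R[i]) :
  (forall eps, 0 < eps -> exists M0, forall M N, (M0 <= M <= N)%N -> cabs (u N - u M) <= eps) ->
  forall (eps : R) M0, (forall M N, (M0 <= M <= N)%N -> cabs (u N - u M) <= eps) ->
  forall M, (M0 <= M)%N -> cabs (lim (u @ \oo) - u M) <= 2 * eps.
Proof.
move=> H.
have part (f : R[i] -> R) : (forall z w, f (z - w) = f z - f w) ->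
    (forall z, `|f z| <= cabs z) -> cvgn (f \o u).
  move=> fB fle; apply: cauchy_cvgn => eps /H[M0 h]; exists M0 => M MM /=.
  by rewrite -fB; apply: le_trans (fle _) _; apply: h; rewrite leqnn.
have cRe : cvgn (@complex.Re R \o u) by apply: part; [case=> a b' []|exact: Re_le_cabs].
have cIm : cvgn (@complex.Im R \o u) by apply: part; [case=> a b' []|exact: Im_le_cabs].
pose z := lim ((@complex.Re R \o u) @ \oo) +i* lim ((@complex.Im R \o u) @ \oo).
have zu eps M0 : (forall M N, (M0 <= M <= N)%N -> cabs (u N - u M) <= eps) ->
    forall M, (M0 <= M)%N -> cabs (z - u M) <= 2 * eps.
  move=> ub M MM; apply: le_trans (cabs_le_ReIm _) _; rewrite mulr_natl mulr2n.
  have bnd (f : R[i] -> R) : (forall v w, f (v - w) = f v - f w) -> (forall v, `|f v| <= cabs v) ->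
      cvgn (f \o u) -> `|lim ((f \o u) @ \oo) - f (u M)| <= eps.
    move=> fB fle /cvgn_eps cf; apply/ler_addgt0Pr => d /cf[M1 h].
    have hm : (M0 <= M <= maxn M M1)%N by rewrite MM leq_maxl.
    have := h (maxn M M1) (leq_maxr _ _); have := ub _ _ hm.
    set w := u (maxn M M1) => h1 h2.
    have h3 : `|f w - f (u M)| <= eps by rewrite -fB; apply: le_trans (fle _) _.
    rewrite -(subrKA (f w)) addrC; apply: le_trans (ler_normD _ _) _.
    by apply: lerD => //; rewrite distrC.
  have -> : complex.Re (z - u M) = lim ((@complex.Re R \o u) @ \oo) - complex.Re (u M).
    by rewrite /z; case: (u M).
  have -> : complex.Im (z - u M) = lim ((@complex.Im R \o u) @ \oo) - complex.Im (u M).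
    by rewrite /z; case: (u M).
  apply: lerD.
    by apply: (bnd (@complex.Re R)) => //; [case=> ? ? []|exact: Re_le_cabs].
  by apply: (bnd (@complex.Im R)) => //; [case=> ? ? []|exact: Im_le_cabs].
have uz : u @ \oo --> z.
  apply: cvgn_complex => eps e0; have [M0 h] := H _ (divr_gt0 e0 (ltr0n R 2)).
  exists M0 => M MM; apply: le_trans (zu _ _ h _ MM) _.
  by rewrite mulrC divfK.
by have -> : lim (u @ \oo) = z by apply: cvg_lim => //; exact: norm_hausdorff.
Qed.

Lemma continuous_uniform_limit (f : I01 R -> R[i]) :
  (forall eps, 0 < eps -> exists2 g : I01 R -> R[i], continuous g &
     forall t, cabs (f t - g t) <= eps) -> continuous f.
Proof.
move=> H t A /nbhs_complexP[eps e0 HA].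
have [g cg fg] := H _ (divr_gt0 e0 (ltr0n R 4)).
have nB : nbhs (g t) [set w | cabs (g t - w) < eps / 4].
  by apply/nbhs_complexP; exists (eps / 4) => //; rewrite divr_gt0.
have nt : nbhs t (g @^-1` [set w | cabs (g t - w) < eps / 4]) := cg t _ nB.
have : nbhs t (f @^-1` A); last by [].
apply: filterS nt => s /= gs; apply: HA.
have -> : f t - f s = (f t - g t) + (g t - g s) + (g s - f s) by rewrite -addrA !subrKA.
apply: le_lt_trans (cabs_le_add _ _) _; apply: le_lt_trans (lerD (cabs_le_add _ _) (lexx _)) _.
by have := fg t; have := fg s; rewrite cabs_distC; lra.
Qed.

Lemma continuous_bigsum (I : Type) (s : seq I) (f : I -> I01 R -> R[i]) :
  (forall i, continuous (f i)) -> continuous (fun t => \sum_(i <- s) f i t).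
Proof.
move=> cf; elim: s => [|i s IH] t.
  have -> : (fun t => \sum_(i <- [::]) f i t) = fun=> 0 by apply/funext => u; rewrite big_nil.
  exact: cst_continuous.
have -> : (fun t => \sum_(j <- i :: s) f j t) = fun t => f i t + \sum_(j <- s) f j t.
  by apply/funext => u; rewrite big_cons.
exact: (continuousD (cf i t) (IH t)).
Qed.

Lemma continuous_dirichlet (q : nat) (s : R) :
  continuous (fun t : I01 R => dirichlet q (val t - s)).
Proof.
rewrite /dirichlet => t.
have cs : continuous (fun t : I01 R => \sum_(n < q) e ((val t - s) * n%:R / q%:R) : R[i]).
  apply: continuous_bigsum => n {}t.
  apply: (@continuous_comp (I01 R) R R[i] (fun t => (val t - s) * n%:R / q%:R) (@e R));
    last exact: continuous_e.
  apply: (@continuousM R (I01 R)); last exact: cst_continuous.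
  apply: (@continuousM R (I01 R)); last exact: cst_continuous.
  apply: (@continuousB R R (I01 R)); last exact: cst_continuous.
  exact: initial_continuous.
exact: (continuousM (@cst_continuous (I01 R) R[i] _ t) (cs t)).
Qed.

(** The removable singularity is avoided: the coefficient is a uniform limit of the trigonometric
    polynomials [- dirichlet q (t - m)]. *)
Lemma continuous_GX_coef m : continuous (fun t : I01 R => GX_coef m (val t)).
Proof.
apply: continuous_uniform_limit => eps e0.
pose q := (Num.bound (128 * ((absz m)%:R + 1) / eps)).+1.
exists (fun t => - dirichlet q (val t - m%:~R)) => [t|t].
  exact: (continuousN (@continuous_dirichlet q m%:~R t)).
rewrite GX_coefE -opprD normcN; apply: le_trans (ekernel_dirichlet _ _) _ => //.
have B0 : 0 <= 128 * ((absz m)%:R + 1) / eps by rewrite !mulr_ge0 ?invr_ge0 ?ltW // addr_ge0.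
have qB : 128 * ((absz m)%:R + 1) / eps <= q%:R.
  by apply/ltW/(lt_trans (archi_boundP B0)); rewrite ltr_nat.
rewrite ler_pdivrMr // ?ltr0n //; move: qB; rewrite ler_pdivrMr // [leRHS]mulrC => qB.
by apply: le_trans qB; rewrite ler_pM2l //; exact: dist_int_le.
Qed.

Lemma continuous_GX_partial (x : int -> R) (M : nat) : continuous (GX_partial x M).
Proof.
apply: continuous_bigsum => j t.
exact: (continuousM (@continuous_GX_coef _ t) (@cst_continuous (I01 R) R[i] _ t)).
Qed.

Lemma toC01E (f : I01 R -> R[i]) : continuous f -> C01_fun (toC01 f) =1 f.
Proof. by move=> cf t; rewrite /toC01; case: pselect. Qed.

(** Up to the factor 1/(2 pi i), the scalar sums that control the tails of [GX_partial]. The term m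
    = 0 is 0, since division by 0 returns 0. *)
Definition hsum (x : int -> R) (M : nat) : R := symsum (fun m => x m / m%:~R) M.

Lemma symsumS (V : nmodType) (f : int -> V) M :
  symsum f M.+1 = symsum f M + (f M.+1%:Z + f (- M.+1%:Z)).
Proof. by rewrite !symsumE big_nat_recr //= addrA. Qed.

Section HarmonicSums.
Variable x : int -> R.
Hypothesis x1 : forall m, `|x m| <= 1.

Lemma hsum_step M N : (0 < M <= N)%N ->
  `|hsum x N - hsum x M| <= 2 * (N - M)%:R / M%:R.
Proof.
move=> /andP[M0]; elim: N => [|N IH]; first by rewrite leqNgt M0.
rewrite leq_eqVlt => /predU1P[<-|]; first by rewrite subrr normr0 subnn mulr0 mul0r.
rewrite ltnS => MN; rewrite /hsum symsumS addrAC.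
apply: le_trans (ler_normD _ _) _.
rewrite subSn // -[(N - M).+1%:R]natr1 mulrDr mulrDl; apply: lerD; first exact: IH.
rewrite mulr1; have M0' : 0 < M%:R :> R by rewrite ltr0n.
have half m : absz m = N.+1 -> `|x m / m%:~R| <= M%:R^-1.
  move=> mN; rewrite normrM normfV norm_intr_absz mN.
  apply: (@le_trans _ _ (1 * N.+1%:R^-1)); first by rewrite ler_wpM2r ?invr_ge0.
  by rewrite mul1r lef_pV2 ?posrE ?ltr0n // ler_nat leqW.
apply: le_trans (ler_normD _ _) _; rewrite mulrDl !mul1r.
by apply: lerD; apply: half => //; rewrite abszN.
Qed.

Lemma sum_inv_sqr_le n : \sum_(j < n) (j.+1%:R ^+ 2)^-1 <= 2 :> R.
Proof.
(* Strengthened by - 1/(n+1) so that induction goes through. *)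
suff : \sum_(j < n.+1) (j.+1%:R ^+ 2)^-1 <= 2 - n.+1%:R^-1 :> R.
  rewrite big_ord_recr /= => h; apply: le_trans (_ : 2 - n.+1%:R^-1 <= _).
    by apply: le_trans h; rewrite lerDl invr_ge0 exprn_ge0.
  by rewrite gerDl oppr_le0 invr_ge0.
elim: n => [|n IH]; first by rewrite big_ord1 expr1n invr1; lra.
rewrite big_ord_recr /=; apply: le_trans (lerD IH (lexx _)) _.
have n1 : 0 < n.+1%:R :> R by rewrite ltr0n.
rewrite -(natr1 n.+1); move: n1; set y := n.+1%:R => y0.
have -> : 2 - y^-1 + ((y + 1) ^+ 2)^-1 = 2 - (y + 1)^-1 - (y * (y + 1) ^+ 2)^-1.
  by field; rewrite !gt_eqF // addr_gt0.
by rewrite gerDl oppr_le0 invr_ge0 mulr_ge0 ?exprn_ge0 ?addr_ge0 // ltW.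
Qed.

(* Along fourth powers the second moments of the increments stay summable against
   the weights j^2, while the oscillation in between is O(1 / j). *)
Lemma hsum_cvg (B : R) :
  (forall n, \sum_(j < n) j.+1%:R ^+ 2 * (hsum x (j.+2 ^ 4) - hsum x (j.+1 ^ 4)) ^+ 2 <= B) ->
  cvgn (hsum x).
Proof.
move=> HB; pose D j := hsum x (j.+2 ^ 4) - hsum x (j.+1 ^ 4).
have cD : cvgn (series D).
  apply: normed_cvg; have : cvgn (series (fun n => `|D n|)); last by [].
  apply: nondecreasing_is_cvgn.
    by apply: nondecreasing_series => n _ _; exact: normr_ge0.
  exists ((2 + B) / 2) => _ [n _ <-]; rewrite /series /= big_mkord.
  (* |D| <= (w + D^2/w)/2 with w = 1/(j+1)^2: the weights are summable, and the weighted squares are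
     bounded by hypothesis. *)
  apply: le_trans (_ : \sum_(j < n) (((j.+1%:R ^+ 2)^-1 + j.+1%:R ^+ 2 * D j ^+ 2) / 2) <= _).
    apply: ler_sum => j _; have j0 : 0 < (j.+1%:R ^+ 2)^-1 :> R by rewrite invr_gt0 exprn_gt0.
    by apply: le_trans (norm_le_AMGM (D j) j0) _; rewrite invrK [D j ^+ 2 * _]mulrC.
  rewrite -mulr_suml ler_pM2r ?invr_gt0 // big_split /=; apply: lerD; last exact: HB.
  exact: sum_inv_sqr_le.
have DE n : hsum x (n.+1 ^ 4) = hsum x 1 + series D n.
  by rewrite /series /= (telescope_sumr (fun j => hsum x (j.+1 ^ 4))) // exp1n addrC subrK.
apply/cvg_ex; exists (hsum x 1 + lim (series D @ \oo)); apply/cvgn_eps => eps e0.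
have /cvgn_eps/(_ _ (divr_gt0 e0 (ltr0n R 2)))[J0 hJ] := cD.
pose J := (J0 + Num.bound (60 / eps))%N.
exists (J.+1 ^ 4)%N => M MJ.
have [j /andP[jJ jM] Mj] : exists2 j, (J <= j)%N && (j.+1 ^ 4 <= M)%N & (M < j.+2 ^ 4)%N.
  have ex : exists j, (M < j.+2 ^ 4)%N.
    by exists M; apply: (@leq_trans (M.+2 ^ 1)); [rewrite expn1|rewrite leq_exp2l].
  case: (ex_minnP ex) => j Mj jmin; exists j => //; apply/andP; split.
    by rewrite -ltnS -ltnS -(ltn_exp2r _ _ (isT : 0 < 4)%N) (leq_ltn_trans MJ).
  case: j Mj jmin => [|j] Mj jmin; first by rewrite (leq_trans _ MJ) // leq_exp2r.
  by rewrite leqNgt; apply/negP => /jmin; rewrite ltnn.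
have h1 := hJ j (leq_trans (leq_addr _ _) jJ).
have h2 : `|hsum x M - hsum x (j.+1 ^ 4)| <= eps / 2.
  apply: le_trans (hsum_step _) _; first by rewrite expn_gt0.
  have j0 : 0 < j.+1%:R :> R by rewrite ltr0n.
  (* (a+1)^4 - a^4 <= 15 a^3 for a = j+1, so the oscillation is at most 30/a; this is the source of
     60/eps in the choice of [J]. *)
  have Mj' : (M - j.+1 ^ 4 <= 15 * j.+1 ^ 3)%N by nia.
  apply: le_trans (_ : 2 * (15 * j.+1 ^ 3)%:R / (j.+1 ^ 4)%:R <= _).
    by rewrite ler_wpM2r ?invr_ge0 // ler_wpM2l // ler_nat.
  have -> : 2 * (15 * j.+1 ^ 3)%:R / (j.+1 ^ 4)%:R = 30 / j.+1%:R :> R.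
    by rewrite natrM !natrX; field; rewrite gt_eqF.
  have B0 : 0 <= 60 / eps by rewrite divr_ge0 // ltW.
  have : 60 / eps <= j.+1%:R.
    by apply/ltW/(lt_le_trans (archi_boundP B0)); rewrite ler_nat; move: jJ; rewrite /J; lia.
  by rewrite ler_pdivrMr // => h; rewrite ler_pdivrMr //; lra.
rewrite -(subrKA (hsum x (j.+1 ^ 4))); apply: le_trans (ler_normD _ _) _.
rewrite [leRHS]splitr; apply: lerD => //.
by rewrite (DE j) opprD addrACA subrr add0r.
Qed.

Lemma GX_partial_cauchy M N (t : I01 R) : (0 < M <= N)%N ->
  cabs (GX_partial x N t - GX_partial x M t) <= 2 * `|hsum x N - hsum x M| + 2 / M%:R.
Proof.
move=> /andP[M0 MN]; rewrite !GX_partialE (symsum_outside _ MN) addrAC subrr add0r.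
have tl m : (M < absz m <= N)%N -> cabs (GX_coef m (val t) - (e (val t) - 1) * GX0 R m)
    <= 1 / ((absz m)%:R * ((absz m)%:R - 1)).
  by move=> mM; rewrite div1r GX_coef_tail ?I01_itv //; lia.
apply: le_trans (tail_bound (K := fun m t => GX_coef m t) ler01 M0 tl x1) _.
rewrite mulr1 lerD2r ler_pM2l //.
have -> : symsum (outside M (fun m => GX0 R m * (x m)%:C)) N =
    (0 +i* (2 * pi))^-1 * (hsum x N - hsum x M)%:C.
  rewrite /hsum (symsum_outside (fun m => x m / m%:~R) MN) addrAC subrr add0r /symsum rmorph_sum mulr_sumr.
  apply: eq_bigr => j _; rewrite /outside; case: leqP => mM; first by rewrite rmorph0 mulr0.
  have m0 : (j%:Z - N%:Z)%:~R != 0 :> R by rewrite intr_eq0; lia.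
  rewrite /GX0.
  have -> : (0 +i* (2 * pi * (j%:Z - N%:Z)%:~R) : R[i]) = (0 +i* (2 * pi)) * ((j%:Z - N%:Z)%:~R : R)%:C.
    by simpc.
  by rewrite (rmorphM (real_complex R)) fmorphV /= invfM -mulrA [_^-1 * (x _)%:C]mulrC.
rewrite normcM normcV cabs_imag cabs_real ler_piMl //.
by rewrite invf_le1 ger0_norm ?mulr_ge0 ?pi_ge0 //; have := pi_ge2 R; lra.
Qed.

(** The partial sums are uniformly Cauchy, so the pointwise limit is continuous and [toC01] does not
    take its default value. *)
Lemma GX_uniform : cvgn (hsum x) ->
  forall eps, 0 < eps -> exists M0, forall M, (M0 <= M)%N -> forall t,
    cabs (GX x t - GX_partial x M t) <= eps.
Proof.
move=> /cvg_ex[l /cvgn_eps hl].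
have cau eps : 0 < eps -> exists M0, forall M N, (M0 <= M <= N)%N -> forall t,
    cabs (GX_partial x N t - GX_partial x M t) <= eps.
  move=> e0; have [M0 h] := hl _ (divr_gt0 e0 (ltr0n R 8)).
  have B0 : 0 <= 4 / eps by rewrite divr_ge0 // ltW.
  exists (M0 + (Num.bound (4 / eps)).+1)%N => M N /andP[MM MN] t.
  have M0' : (0 < M)%N by lia.
  have M1 : 0 < M%:R :> R by rewrite ltr0n.
  apply: le_trans (GX_partial_cauchy t (_ : (0 < M <= N)%N)) _; first by rewrite M0'.
  have h1 := h M (_ : (M0 <= M)%N); have h2 := h N (_ : (M0 <= N)%N).
  have h3 : `|hsum x N - hsum x M| <= eps / 4.
    rewrite -(subrKA l); apply: le_trans (ler_normD _ _) _; rewrite [X in _ + X]distrC.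
    by apply: le_trans (lerD (h2 _) (h1 _)) _; [lia|lia|lra].
  have h4 : 2 / M%:R <= eps / 2.
    have : 4 / eps <= M%:R.
      by apply/ltW/(lt_le_trans (archi_boundP B0)); rewrite ler_nat; lia.
    by rewrite ler_pdivrMr // => h4; rewrite ler_pdivrMr //; lra.
  lra.
pose g (t : I01 R) := lim (GX_partial x M t @[M --> \oo]).
have gu eps : 0 < eps -> exists M0, forall M, (M0 <= M)%N -> forall t,
    cabs (g t - GX_partial x M t) <= eps.
  move=> e0; have [M0 h] := cau _ (divr_gt0 e0 (ltr0n R 2)).
  exists M0 => M MM t; have -> : eps = 2 * (eps / 2) by rewrite mulrC divfK.
  have cu : forall d, 0 < d -> exists M1, forall M N, (M1 <= M <= N)%N ->
      cabs (GX_partial x N t - GX_partial x M t) <= d.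
    by move=> d /cau[M1 h1]; exists M1 => M' N' h'; exact: h1.
  exact: (cauchy_complex cu (fun M' N' h' => h M' N' h' t) MM).
have cg : continuous g.
  apply: continuous_uniform_limit => eps /gu[M0 h]; exists (GX_partial x M0).
    exact: continuous_GX_partial.
  by move=> t; exact: h.
move=> eps /gu[M0 h]; exists M0 => M MM t; rewrite /GX toC01E //; exact: h.
Qed.

End HarmonicSums.

End UniformLimits.

(** * Integrals of functions of finitely many signs *)

Section IntegralNullSet.
Context (d : measure_display) (T : measurableType d) (R : realType).
Variable P : probability T R.
Implicit Types (f g : T -> \bar R) (D : set T).
Local Open Scope ereal_scope.

(** Monotonicity read off the supremum over simple functions, hence valid for nonmeasurable
    integrands. *)
Lemma ge0_le_integralT f g : (forall x, 0 <= f x) -> (forall x, f x <= g x) ->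
  \int[P]_x f x <= \int[P]_x g x.
Proof.
move=> f0 fg; have g0 x : 0 <= g x by apply: le_trans (fg x).
rewrite !ge0_integralTE //; apply: ereal_sup_le => _ [h /= hf <-].
by exists h => //= x; apply: le_trans (fg x).
Qed.

(* No measurability of f is assumed outside D: phi (GX _) is junk there. *)
Lemma ge0_integral_null_set D f (B : R) : measurable D -> P (~` D) = 0 ->
  (forall x, 0 <= f x) -> (forall x, f x <= B%:E) -> measurable_fun D f ->
  \int[P]_x f x = \int[P]_(x in D) f x.
Proof.
move=> mD D0 f0 fB mf; rewrite [RHS]integral_mkcond.
have B0 : 0 <= B%:E by apply: le_trans (f0 point) (fB _).
have fD0 x : 0 <= (f \_ D) x by rewrite patchE; case: ifP.
have mfD : measurable_fun setT (f \_ D) by apply/(measurable_restrictT _ mD).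
have mN : measurable (~` D) by exact: measurableC.
(* A measurable majorant: f on [D] and the constant B off it, equal almost everywhere to the
   restriction of f. *)
pose k x := (f \_ D) x + (B * \1_(~` D) x)%:E.
have mk : measurable_fun setT k.
  apply: emeasurable_funD => //; apply/measurable_EFinP.
  by apply: measurable_funM => //; exact: measurable_indic.
apply/eqP; rewrite eq_le; apply/andP; split; last first.
  by apply: ge0_le_integralT => // x; rewrite patchE; case: ifP.
apply: (@le_trans _ _ (\int[P]_x k x)).
  apply: ge0_le_integralT => // x; rewrite /k patchE; case: ifPn => xD.
    by rewrite leeDl // lee_fin mulr_ge0.
  by rewrite add0e indicE in_setC xD mulr1.
rewrite (ae_eq_integral (f \_ D)) //.
exists (~` D); split => // x /= nk; rewrite /setC /= => xD; apply: nk => _.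
by rewrite /k indicE memNset ?mulr0 ?adde0 //= => /(_ xD).
Qed.

Lemma integral_null_set D (f : T -> R) (B : R) : measurable D -> P (~` D) = 0 ->
  (forall x, (`|f x| <= B)%R) -> measurable_fun D f ->
  \int[P]_x (f x)%:E = \int[P]_(x in D) (f x)%:E.
Proof.
move=> mD D0 fB /measurable_EFinP mf; rewrite integralE [RHS]integralE.
congr (_ - _); apply: (@ge0_integral_null_set D _ B) => //.
- move=> x; rewrite funeposE /= ge_max; apply/andP; split.
    by rewrite lee_fin; apply: le_trans (fB x); exact: ler_norm.
  by rewrite lee_fin; apply: le_trans (fB x).
- exact: measurable_funepos.
- move=> x; rewrite funenegE /= ge_max; apply/andP; split.
    by rewrite lee_fin; apply: le_trans (fB x); rewrite -normrN; exact: ler_norm.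
  by rewrite lee_fin; apply: le_trans (fB x).
- exact: measurable_funeneg.
Qed.

Lemma bounded_integrable D (f : T -> R) (B : R) : measurable D ->
  (forall x, D x -> (`|f x| <= B)%R) -> measurable_fun D f -> P.-integrable D (EFin \o f).
Proof.
move=> mD fB mf.
apply: (@le_integrable _ _ _ P D mD _ (cst B%:E)).
- exact/measurable_EFinP.
- by move=> x Dx /=; rewrite lee_fin; apply: le_trans (fB x Dx) _; exact: ler_norm.
- by apply: finite_measure_integrable_cst.
Qed.

(** The first conclusion is how functionals of [GX] are shown to be measurable on [D]. *)
Lemma bounded_cvg_Rintegral D (u : nat -> T -> R) (f : T -> R) (B : R) : measurable D ->
  (forall n, measurable_fun D (u n)) -> (forall n x, D x -> (`|u n x| <= B)%R) ->
  (forall x, D x -> (u n x @[n --> \oo] --> f x)%classic) ->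
  measurable_fun D f /\
  ((\int[P]_(x in D) u n x)%R @[n --> \oo] --> (\int[P]_(x in D) f x)%R)%classic.
Proof.
move=> mD mu uB uf.
have mf : measurable_fun D f by apply: measurable_fun_cvg mu uf.
have fB x : D x -> (`|f x| <= B)%R.
  move=> Dx; have : (`|u n x|%R @[n --> \oo] --> `|f x|%R)%classic.
    by apply: cvg_norm; exact: uf.
  move=> /cvgr_to_le; apply; near=> n; exact: uB.
split => //; apply: fine_cvg.
rewrite fineK; last first.
  by apply: integrable_fin_num => //; exact: bounded_integrable fB mf.
apply: (@dominated_cvg _ _ _ P D mD _ _ (cst B%:E)).
- by move=> n; apply/measurable_EFinP; exact: mu.
- by move=> x Dx; apply: cvg_EFin; [near=> n|exact: uf].
- by [].
- exact: finite_measure_integrable_cst.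
- by move=> n x Dx; rewrite /= lee_fin; exact: uB.
Unshelve. all: by end_near. Qed.

End IntegralNullSet.

(** * Sign patterns of independent variables *)

Section RandomSigns.
Context (R : realType) (d : measure_display) (T : measurableType d).
Variable P : probability T R.
Variable X : int -> {RV P >-> R}.
Hypothesis iidX : iid_signs P X.

Definition signs_ae : set T := [set w | forall m, X m w = 1 \/ X m w = -1].

Let sign_set (m : int) (b : bool) : set T := X m @^-1` [set (-1) ^+ b].

Let sign_setE m b : P (sign_set m b) = (2^-1)%:E.
Proof. by have [_ /(_ m)[h1 h2]] := iidX; case: b. Qed.

Let measurable_sign_set m b : measurable (sign_set m b).
Proof. by apply: measurable_funPTI; exact: measurable_set1. Qed.

Let signs_at m : set T := sign_set m false `|` sign_set m true.

Let signs_at_null m : P (~` signs_at m) = 0%E.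
Proof.
have mS : measurable (signs_at m) by apply: measurableU; exact: measurable_sign_set.
rewrite probability_setC // /signs_at measureU //; last first.
  apply/seteqP; split => // w [/= h1 h2]; move: h2; rewrite /sign_set /= h1 expr0 expr1.
  by move=> /eqP; rewrite -subr_eq0 opprK -(natrD R 1 1) pnatr_eq0.
transitivity (1 - ((2^-1)%:E + (2^-1)%:E) : \bar R)%E.
  by congr (_ - (_ + _))%E; exact: sign_setE.
by rewrite -EFinD -div1r -splitr subrr.
Qed.
Lemma signs_aeE : signs_ae = \bigcap_n (signs_at (Posz n) `&` signs_at (Negz n)).
Proof.
apply/seteqP; split => [w Hw n _ /=|w Hw [n|n]].
- by split; rewrite /signs_at /sign_set /= expr0 expr1; exact: Hw.
- by have [] := Hw n I.
- by have [] := Hw n I.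
Qed.

Lemma measurable_signs_ae : measurable signs_ae.
Proof.
rewrite signs_aeE; apply: bigcapT_measurable => n.
by apply: measurableI; apply: measurableU; exact: measurable_sign_set.
Qed.

Lemma signs_ae_null : P (~` signs_ae) = 0%E.
Proof.
have mS m : measurable (~` signs_at m).
  by apply/measurableC/measurableU; exact: measurable_sign_set.
rewrite signs_aeE setC_bigcap; apply/eqP; rewrite -measure_le0.
have -> : \bigcup_n ~` (signs_at (Posz n) `&` signs_at (Negz n))
   = \bigcup_n (~` signs_at (Posz n) `|` ~` signs_at (Negz n)).
  by apply: eq_bigcupr => n _; rewrite setCI.
have null n : P (~` signs_at (Posz n) `|` ~` signs_at (Negz n)) = 0%E.
  apply: null_set_setU; [exact: mS|exact: mS|exact: signs_at_null|exact: signs_at_null].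
have mU n : measurable (~` signs_at (Posz n) `|` ~` signs_at (Negz n)).
  by apply: measurableU; exact: mS.
have := measure_sigma_subadditive P mU (bigcupT_measurable _ mU) (@subset_refl _ _).
by move=> /le_trans; apply; rewrite eseries0 // => n _ _; exact: null.
Qed.

Lemma sign_pattern_prob M (f : 'I_M.*2.+1 -> bool) :
  let E := [set w | forall j : 'I_M.*2.+1, X (j%:Z - M%:Z) w = (-1) ^+ f j] in
  measurable E /\ P E = ((2 ^ M.*2.+1)%:R^-1)%:E.
Proof.
move=> E; pose s := [seq (val j)%:Z - M%:Z | j <- enum 'I_M.*2.+1].
(* Independence asks for a set at every integer; outside |m| <= M [inord] supplies an arbitrary
   one. *)
pose A (m : int) : set R := [set (-1) ^+ f (inord (absz (m + M%:Z)))].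
have mA m : measurable (A m) by exact: measurable_set1.
have us : uniq s.
  rewrite map_inj_uniq ?enum_uniq // => i j /eqP; rewrite (inj_eq (addIr _)) => /eqP[].
  exact: val_inj.
have Aj (j : 'I_M.*2.+1) : A (j%:Z - M%:Z) = [set (-1) ^+ f j].
  by rewrite /A subrK absz_nat inord_val.
have EE : E = \bigcap_(i in [set` s]) (X i @^-1` A i).
  apply/seteqP; split => [w Ew m /= /mapP[j _ ->]|w Ew j].
    by rewrite /= Aj /=; exact: Ew.
  by have := Ew (j%:Z - M%:Z); rewrite /= Aj; apply; apply/mapP; exists j; rewrite ?mem_enum.
split.
  by rewrite EE bigcap_seq; apply: bigsetI_measurable => m _; apply: measurable_funPTI.
have [indX _] := iidX; rewrite EE (indX s A us mA) big_map big_enum /=.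
rewrite (eq_bigr (fun=> (2^-1)%:E)); last by move=> j _; rewrite Aj; exact: sign_setE.
rewrite -(big_morph EFin EFinM (erefl _)) prodr_const card_ord.
by rewrite natrX exprVn.
Qed.

(** On [D] exactly one pattern occurs, so V is there the finite sum of the [G f] times the
    indicators of the patterns, each of probability 2^-(2M+1). *)
Lemma Rintegral_signs M (D : set T) (V : T -> R) (G : {ffun 'I_M.*2.+1 -> bool} -> R) :
  measurable D -> D `<=` signs_ae -> P (~` D) = 0%E ->
  (forall w (f : {ffun 'I_M.*2.+1 -> bool}), D w -> (forall j : 'I_M.*2.+1, X (j%:Z - M%:Z) w = (-1) ^+ f j) -> V w = G f) ->
  measurable_fun D V /\
  \int[P]_(w in D) V w = (2 ^ M.*2.+1)%:R^-1 * \sum_f G f.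
Proof.
move=> mD DS D0 VG.
pose E (f : {ffun 'I_M.*2.+1 -> bool}) :=
  [set w | forall j : 'I_M.*2.+1, X (j%:Z - M%:Z) w = (-1) ^+ f j].
have mE f : measurable (E f) by have [] := sign_pattern_prob f.
have VE w : D w -> V w = \sum_f G f * \1_(E f) w.
  move=> Dw.
  pose f0 : {ffun 'I_M.*2.+1 -> bool} := [ffun j : 'I_M.*2.+1 => X (j%:Z - M%:Z) w == -1].
  have n11 : (1 : R) == -1 = false by rewrite -subr_eq0 opprK -(natrD R 1 1) pnatr_eq0.
  have Ef0 : E f0 w.
    move=> j; rewrite ffunE; have [->|->] := DS _ Dw (j%:Z - M%:Z).
      by rewrite n11.
    by rewrite eqxx.
  rewrite (VG _ _ Dw Ef0) (bigD1 f0) //= big1 ?addr0.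
    by rewrite indicE mem_set // mulr1.
  move=> f ff0; rewrite indicE memNset ?mulr0 // => Ef; case/eqP: ff0.
  apply/ffunP => j; have := Ef0 j; rewrite (Ef j).
  by case: (f j); case: (f0 j) => //; rewrite expr0 expr1 => /eqP; rewrite ?n11 // eq_sym n11.
have mV f : measurable_fun D (fun w => G f * \1_(E f) w).
  by apply: measurable_funM => //; exact: measurable_indic.
split.
  apply: eq_measurable_fun (measurable_sum (index_enum _) mV) => w.
  by rewrite inE => Dw; rewrite VE.
have VE' : {in D, V =1 fun w => \sum_f G f * \1_(E f) w} by move=> w; rewrite inE => /VE.
rewrite (eq_Rintegral P VE').
have iV f : P.-integrable D (EFin \o (fun w => G f * \1_(E f) w)).
  apply: (@bounded_integrable _ _ _ P D _ `|G f|) => // w _.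
  rewrite normrM ler_piMr // indicE; case: (_ \in _) => /=; rewrite ?normr1 ?normr0 //.
rewrite /Rintegral; under eq_integral do rewrite -sumEFin.
rewrite integral_sum //.
have intE f : (\int[P]_(w in D) (G f * \1_(E f) w)%:E = (G f * (2 ^ M.*2.+1)%:R^-1)%:E)%E.
  under eq_integral do rewrite EFinM.
  rewrite integralZl //; last first.
    apply: (@bounded_integrable _ _ _ P D _ 1) => // w _.
    by rewrite indicE; case: (_ \in _) => /=; rewrite ?normr1 ?normr0.
  rewrite integral_indic // EFinM; congr (_ * _)%E.
  have [_ <-] := sign_pattern_prob f; rewrite -/(E f).
  rewrite -[in RHS](setIT (E f)) -(setvU D) setIUr measureU //.
  - rewrite [X in _ = (X + _)%E](_ : _ = 0%E) ?add0e //.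
    by apply/eqP; rewrite -measure_le0 -D0 le_measure ?inE //; [apply: measurableI => //; exact: measurableC|exact: measurableC].
  - by apply: measurableI => //; exact: measurableC.
  - exact: measurableI.
  - by rewrite setIACA setICl setI0.
under eq_bigr do rewrite intE.
by rewrite sumEFin /= mulr_sumr; apply: eq_bigr => f _; rewrite mulrC.
Qed.

End RandomSigns.

(** * Almost sure convergence *)

(** Off the diagonal, flipping the sign at i pairs the patterns with opposite contributions. *)
Lemma rademacher_orth (R : comPzRingType) (n : nat) (i j : 'I_n) :
  \sum_(f : {ffun 'I_n -> bool}) (-1) ^+ f i * (-1) ^+ f j = (if i == j then (2 ^ n)%:R else 0) :> R.
Proof.
case: eqP => [->|/eqP ij].
  under eq_bigr do rewrite -expr2 sqrr_sign.
  by rewrite sumr_const card_ffun card_bool card_ord.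
pose flip (f : {ffun 'I_n -> bool}) := [ffun k => f k (+) (k == i)].
have flipK : involutive flip by move=> f; apply/ffunP => k; rewrite !ffunE addbK.
rewrite (bigID (fun f : {ffun 'I_n -> bool} => f i)) /=.
rewrite [X in _ + X](reindex_inj (inv_inj flipK)) /=.
apply/eqP; rewrite addr_eq0 -sumrN; apply/eqP.
apply: eq_big => [f|f fi]; first by rewrite ffunE eqxx addbT negbK.
by rewrite !ffunE eqxx (negbTE (_ : j != i)) 1?eq_sym // addbT addbF fi /= expr0 expr1; ring.
Qed.

Lemma rademacher_second_moment (R : realFieldType) (n : nat) (b : 'I_n -> R) :
  (2 ^ n)%:R^-1 * (\sum_(f : {ffun 'I_n -> bool}) (\sum_j b j * (-1) ^+ f j) ^+ 2)
  = \sum_j b j ^+ 2.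
Proof.
have t0 : (2 ^ n)%:R != 0 :> R by rewrite pnatr_eq0 expn_eq0.
transitivity ((2 ^ n)%:R^-1 * \sum_i \sum_j b i * b j *
    \sum_(f : {ffun 'I_n -> bool}) (-1) ^+ f i * (-1) ^+ f j).
  congr (_ * _); under eq_bigr do rewrite expr2 big_distrlr /=.
  rewrite exchange_big; apply: eq_bigr => i _; rewrite exchange_big; apply: eq_bigr => j _.
  by rewrite mulr_sumr; apply: eq_bigr => f _; ring.
rewrite mulr_sumr; apply: eq_bigr => i _.
rewrite (bigD1 i) //= rademacher_orth eqxx big1 ?addr0; last first.
  by move=> j ji; rewrite rademacher_orth eq_sym (negbTE ji) mulr0.
by rewrite mulrC mulfK.
Qed.

Section RandomHarmonicSums.
Context (R : realType) (d : measure_display) (T : measurableType d).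
Variable P : probability T R.
Variable X : int -> {RV P >-> R}.
Hypothesis iidX : iid_signs P X.

Local Notation OO := (signs_ae X).

Lemma second_moment_signs M (b : int -> R) :
  measurable_fun OO (fun w => symsum (fun m => b m * X m w) M ^+ 2) /\
  \int[P]_(w in OO) (symsum (fun m => b m * X m w) M ^+ 2) = symsum (fun m => b m ^+ 2) M.
Proof.
pose G (f : {ffun 'I_M.*2.+1 -> bool}) : R :=
  (\sum_(j < M.*2.+1) b (j%:Z - M%:Z) * (-1) ^+ f j) ^+ 2.
have VG w (f : {ffun 'I_M.*2.+1 -> bool}) : OO w ->
    (forall j : 'I_M.*2.+1, X (j%:Z - M%:Z) w = (-1) ^+ f j) ->
    symsum (fun m => b m * X m w) M ^+ 2 = G f.
  by move=> _ Xf; congr (_ ^+ 2); apply: eq_bigr => j _; rewrite Xf.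
have [mV ->] := Rintegral_signs iidX (measurable_signs_ae X) (@subset_refl _ _)
  (signs_ae_null iidX) VG.
by split => //; rewrite rademacher_second_moment.
Qed.

Lemma hsum_diffE (x : int -> R) M N : (0 < M <= N)%N ->
  hsum x N - hsum x M = symsum (fun m => outside M (fun m => m%:~R^-1) m * x m) N.
Proof.
move=> /andP[_ MN]; rewrite /hsum (symsum_outside _ MN) addrAC subrr add0r.
by apply: eq_symsum => m _; rewrite /outside; case: ifP => _; rewrite ?mul0r // mulrC.
Qed.

Let W j w : R := j.+1%:R ^+ 2 * (hsum (X ^~ w) (j.+2 ^ 4) - hsum (X ^~ w) (j.+1 ^ 4)) ^+ 2.

Let a4 j : (0 < j.+1 ^ 4 <= j.+2 ^ 4)%N.
Proof. by apply/andP; split; [rewrite expn_gt0|rewrite leq_exp2r]. Qed.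

Let WE j w : W j w = j.+1%:R ^+ 2 *
  symsum (fun m => outside (j.+1 ^ 4) (fun m => m%:~R^-1) m * X m w) (j.+2 ^ 4) ^+ 2.
Proof. by rewrite /W hsum_diffE. Qed.

Let mW j : measurable_fun OO (W j).
Proof.
rewrite (_ : W j = fun w => j.+1%:R ^+ 2 *
  symsum (fun m => outside (j.+1 ^ 4) (fun m => m%:~R^-1) m * X m w) (j.+2 ^ 4) ^+ 2).
  by apply: measurable_funM => //; have [] := second_moment_signs (j.+2 ^ 4) (outside (j.+1 ^ 4) (fun m => m%:~R^-1)).
by apply/funext => w; exact: WE.
Qed.

Let W_ge0 j w : 0 <= W j w.
Proof. by rewrite mulr_ge0 ?sqr_ge0 // exprn_ge0. Qed.

(** The increment from (j+1)^4 to (j+2)^4 has second moment at most 2/(j+1)^4; the weight (j+1)^2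
    leaves a summable 2/(j+1)^2. *)
Let intW j : (\int[P]_(w in OO) (W j w)%:E <= (2 * (j.+1%:R ^+ 2)^-1)%:E)%E.
Proof.
pose b := outside (j.+1 ^ 4) (fun m => m%:~R^-1) : int -> R.
have [mS iS] := second_moment_signs (j.+2 ^ 4) b.
have S_ge0 w : 0 <= symsum (fun m => b m * X m w) (j.+2 ^ 4) ^+ 2 by exact: sqr_ge0.
under eq_integral do rewrite WE EFinM.
rewrite ge0_integralZl_EFin //; last 3 first.
- exact: measurable_signs_ae.
- by move=> w _; rewrite lee_fin.
- exact/measurable_EFinP.
have bnd w : OO w -> `|symsum (fun m => b m * X m w) (j.+2 ^ 4) ^+ 2| <= symsum (fun m => `|b m|) (j.+2 ^ 4) ^+ 2.
  move=> Ow; rewrite normrX lerXn2r ?nnegrE //; first by apply: sumr_ge0.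
  apply: le_trans (ler_norm_sum _ _ _) _; apply: ler_sum => i _.
  by rewrite normrM; have [->|->] := Ow (i%:Z - (j.+2 ^ 4)%:Z); rewrite ?normrN normr1 mulr1.
have iint := bounded_integrable P (measurable_signs_ae X) bnd mS.
have -> : (\int[P]_(w in OO) (symsum (fun m => b m * X m w) (j.+2 ^ 4) ^+ 2)%:E
    = (symsum (fun m => b m ^+ 2) (j.+2 ^ 4))%:E)%E.
  by rewrite -iS /Rintegral fineK //; apply: integrable_fin_num => //; exact: measurable_signs_ae.
rewrite -EFinM lee_fin.
apply: (@le_trans _ _ (j.+1%:R ^+ 2 * (2 / (j.+1 ^ 4)%:R))); last first.
  rewrite natrX le_eqVlt; apply/orP; left; apply/eqP.
  have : j.+1%:R != 0 :> R by rewrite pnatr_eq0.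
  by move: (j.+1%:R) => y y0; field.
rewrite ler_wpM2l ?exprn_ge0 //.
apply: le_trans (symsum_outside_inv_le R (j.+2 ^ 4) (_ : 0 < j.+1 ^ 4)%N); last first.
  by rewrite expn_gt0.
apply: ler_symsum => m _; rewrite /b /outside; case: leqP => mM; first by rewrite expr0n.
have a1 : 2 <= (absz m)%:R :> R.
  by rewrite (ler_nat R 2); have := expn_gt0 j.+1 4; lia.
rewrite exprVn -[m%:~R ^+ 2]real_normK ?num_real // norm_intr_absz lef_pV2 ?posrE; first by nra.
  by rewrite exprn_gt0; lra.
by rewrite mulr_gt0; lra.
Qed.

(** The sum of all [W j] has integral at most 4, so it is finite almost everywhere; its value at w
    is the bound that [hsum_cvg] asks for. *)
Lemma signs_hsum_cvg : exists D : set T,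
  [/\ measurable D, D `<=` OO, P (~` D) = 0%E & forall w, D w -> cvgn (hsum (X ^~ w))].
Proof.
have mO := measurable_signs_ae X.
pose S w := (\sum_(j <oo) (W j w)%:E)%E.
have mWE j : measurable_fun OO (fun w => (W j w)%:E) by apply/measurable_EFinP.
have iS : P.-integrable OO S.
  apply/integrableP; split.
    by apply: ge0_emeasurable_sum => // j w _ _; rewrite lee_fin.
  under eq_integral => w _.
    rewrite gee0_abs; last by apply: nneseries_ge0 => j _ _; rewrite lee_fin.
    over.
  rewrite integral_nneseries //; last by move=> j w _; rewrite lee_fin.
  apply: (@le_lt_trans _ _ 4%:E); last exact: ltry.
  have i0 j : (0 <= \int[P]_(w in OO) (W j w)%:E)%E.
    by apply: integral_ge0 => w _; rewrite lee_fin.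
  apply: lime_le; first by apply: is_cvg_nneseries => j _ _; exact: i0.
  apply: nearW => n; rewrite big_mkord.
  apply: (le_trans (lee_sum _ (fun (j : 'I_n) _ => intW j))).
  rewrite sumEFin lee_fin -mulr_sumr.
  by have := sum_inv_sqr_le R n; lra.
have [N [mN N0 HN]] := integrable_ae mO iS.
exists (OO `\` N); split.
- exact: measurableD.
- by move=> w [].
- rewrite setDE setCI setCK; apply: null_set_setU => //; first exact: measurableC.
  exact: signs_ae_null.
move=> w [Ow Nw]; have x1 m : `|X m w| <= 1.
  by have [->|->] := Ow m; rewrite ?normrN normr1.
have Sw : S w \is a fin_num.
  by apply: contrapT => nS; apply: Nw; apply: HN => /= h; apply: nS; exact: h.
apply: (@hsum_cvg R (X ^~ w) x1 (fine (S w))) => n.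
rewrite -lee_fin fineK // -sumEFin /S.
have := @nneseries_lim_ge _ (fun j => (W j w)%:E) xpredT 0 n.
rewrite big_mkord; apply => j _ _; by rewrite lee_fin.
Qed.

Lemma GX_ae : exists D : set T,
  [/\ measurable D, D `<=` OO, P (~` D) = 0%E &
    forall w, D w -> forall eps, 0 < eps -> exists M0, forall M, (M0 <= M)%N -> forall t,
      cabs (GX (X ^~ w) t - GX_partial (X ^~ w) M t) <= eps].
Proof.
have [D [mD DO D0 DH]] := signs_hsum_cvg; exists D; split => // w Dw.
apply: GX_uniform (DH w Dw) => m.
by have [->|->] := DO _ Dw m; rewrite ?normrN normr1.
Qed.

End RandomHarmonicSums.

(** * Lipschitz regularization and conclusion *)

Section LipschitzRegularization.
Variable R : realType.
Implicit Types (f g : C01 R) (psi phi : C01 R -> R).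

(** Stated with pointwise distances, so that estimates uniform in t apply directly. *)
Definition lipschitz_sup psi (L : R) := forall f g b,
  (forall t, cabs (f t - g t) <= b) -> `|psi f - psi g| <= L * b.

Definition continuous_sup phi := forall f eps, 0 < eps ->
  exists2 dl, 0 < dl & forall g, supnorm (fun t => f t - g t) < dl -> `|phi f - phi g| <= eps.

Lemma I01_point : I01 R.
Proof. by exists 0; rewrite inE /= in_itv /= lexx ler01. Qed.

Lemma supnorm_le (h : I01 R -> R[i]) (b : R) :
  (forall t, cabs (h t) <= b) -> supnorm h <= b.
Proof.
move=> hb; apply: ge_sup; first by exists (cabs (h I01_point)); exists I01_point.
by move=> _ [t _ <-].
Qed.

Lemma cabs_sub_le_supnorm f g t : cabs (f t - g t) <= supnorm (fun t => f t - g t).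
Proof.
apply: (@cabs_le_supnorm R (fun t => f t - g t)) => s.
exact: (continuousB (@continuous_C01 R f s) (@continuous_C01 R g s)).
Qed.

Lemma supnorm_ge0 f g : 0 <= supnorm (fun t => f t - g t).
Proof. exact: le_trans (cabs_ge0 _) (cabs_sub_le_supnorm f g I01_point). Qed.

Lemma cabs_sub_toC01 f (h : I01 R -> R[i]) (ch : continuous h) t :
  cabs (f t - toC01 h t) = cabs (f t - h t).
Proof. by rewrite (toC01E ch). Qed.

(** The Pasch-Hausdorff envelope of phi: for bounded phi, its largest n-Lipschitz minorant. *)
Definition lipreg phi (n : nat) f : R :=
  inf [set phi g + n%:R * supnorm (fun t => f t - g t) | g in [set: C01 R]].

Section Bounded.
Variables (phi : C01 R -> R) (B : R).
Hypothesis phiB : forall f, `|phi f| <= B.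

Lemma lipreg_has_lbound n f :
  lbound [set phi g + n%:R * supnorm (fun t => f t - g t) | g in [set: C01 R]] (- B).
Proof.
move=> _ [g _ <-]; apply: (@le_trans _ _ (phi g)); first by have := phiB g; rewrite ler_norml => /andP[].
by rewrite lerDl mulr_ge0 // supnorm_ge0.
Qed.

Lemma lipreg_le n f g : lipreg phi n f <= phi g + n%:R * supnorm (fun t => f t - g t).
Proof. by apply: ge_inf; [exists (- B); exact: lipreg_has_lbound|exists g]. Qed.

Lemma lipreg_ge n f (c : R) :
  (forall g, c <= phi g + n%:R * supnorm (fun t => f t - g t)) -> c <= lipreg phi n f.
Proof. by move=> h; apply: lb_le_inf; [exists (phi f + n%:R * supnorm (fun t => f t - f t)); exists f|move=> _ [g _ <-]]. Qed.

Lemma lipreg_le_fun n f : lipreg phi n f <= phi f.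
Proof.
apply: le_trans (lipreg_le n f f) _; rewrite gerDl mulr_ge0_le0 //.
by apply: supnorm_le => t; rewrite subrr normc0.
Qed.

Lemma lipreg_bounded n f : `|lipreg phi n f| <= B.
Proof.
rewrite ler_norml; apply/andP; split.
  by apply: lipreg_ge => g; apply: lipreg_has_lbound; exists g.
by apply: le_trans (lipreg_le_fun n f) _; apply: le_trans (ler_norm _) _.
Qed.

Lemma lipreg_lipschitz n : lipschitz_sup (lipreg phi n) n%:R.
Proof.
have half f g b : (forall t, cabs (f t - g t) <= b) -> lipreg phi n f - n%:R * b <= lipreg phi n g.
  move=> fgb; apply: lipreg_ge => k; rewrite lerBlDr.
  apply: le_trans (lipreg_le n f k) _; rewrite -addrA lerD2l -mulrDr ler_wpM2l //.
  apply: supnorm_le => t; rewrite -(subrKA (g t)) addrC; apply: le_trans (cabs_le_add _ _) _.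
  by apply: lerD => //; exact: cabs_sub_le_supnorm.
move=> f g b fgb; rewrite ler_norml; apply/andP; split.
  by rewrite lerBrDl; apply: half => t; rewrite cabs_distC.
by rewrite lerBlDr addrC -lerBlDr; apply: half.
Qed.

(** Within distance dl of f, continuity keeps phi g above phi f - eps; farther away the penalty n dl
    >= 2B exceeds the oscillation of phi. *)
Lemma lipreg_cvg f : continuous_sup phi -> lipreg phi n f @[n --> \oo] --> phi f.
Proof.
move=> cphi; apply/cvgn_eps => eps e0; have [dl dl0 H] := cphi f eps e0.
have B0 : 0 <= B by apply: le_trans (phiB f).
have b0 : 0 <= 2 * B / dl by rewrite !mulr_ge0 // invr_ge0 ltW.
exists (Num.bound (2 * B / dl)) => n nB.
have nB' : 2 * B <= n%:R * dl.
  rewrite -ler_pdivrMr //; apply/ltW/(lt_le_trans (archi_boundP b0)); by rewrite ler_nat.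
rewrite distrC ger0_norm ?subr_ge0 ?lipreg_le_fun // lerBlDr -lerBlDl.
apply: lipreg_ge => g; have [gd|gd] := ltP (supnorm (fun t => f t - g t)) dl.
  apply: (@le_trans _ _ (phi g)); last by rewrite lerDl mulr_ge0 // supnorm_ge0.
  by have := H g gd; rewrite ler_norml => /andP[_]; lra.
have h1 := phiB f; have h2 := phiB g; move: h1 h2; rewrite !ler_norml => /andP[_ h1] /andP[h2 _].
have : n%:R * dl <= n%:R * supnorm (fun t => f t - g t) by rewrite ler_wpM2l.
lra.
Qed.

End Bounded.
End LipschitzRegularization.

(** * From Lipschitz to bounded continuous functionals *)

Section Convergence.
Context (R : realType) (d : measure_display) (T : measurableType d).
Variable P : probability T R.
Variable X : int -> {RV P >-> R}.
Hypothesis iidX : iid_signs P X.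

Variable D : set T.
Hypotheses (mD : measurable D) (DO : D `<=` signs_ae X) (D0 : P (~` D) = 0%E).
Hypothesis DGX : forall w, D w -> forall eps, 0 < eps -> exists M0, forall M, (M0 <= M)%N ->
  forall t, cabs (GX (X ^~ w) t - GX_partial (X ^~ w) M t) <= eps.

(** A finite pattern extended to all integers; the values outside |m| <= M are arbitrary and never
    read by [GX_partial _ M]. *)
Definition sign_seq M (f : {ffun 'I_M.*2.+1 -> bool}) (m : int) : R :=
  (-1) ^+ f (inord (absz (m + M%:Z))).

Definition GX_sign M (f : {ffun 'I_M.*2.+1 -> bool}) : C01 R :=
  toC01 (GX_partial (sign_seq f) M).

Lemma GX_partial_sign M (f : {ffun 'I_M.*2.+1 -> bool}) (x : int -> R) :
  (forall j : 'I_M.*2.+1, x (j%:Z - M%:Z) = (-1) ^+ f j) ->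
  GX_partial x M = GX_partial (sign_seq f) M.
Proof.
move=> xf; apply/funext => t; apply: eq_bigr => j _.
by rewrite xf /sign_seq subrK absz_nat inord_val.
Qed.

Section Lipschitz.
Variables (psi : C01 R -> R) (L B : R).
Hypotheses (L0 : 0 < L) (psiL : lipschitz_sup psi L) (psiB : forall f, `|psi f| <= B).

Let avg M := (2 ^ M.*2.+1)%:R^-1 * \sum_f psi (@GX_sign M f).

(** [avg M] is the integral of psi at the M-th partial sum, which converges to [GX] uniformly in t
    at every point of [D]; bounded convergence applies. *)
Lemma lipschitz_limit :
  measurable_fun D (fun w => psi (GX (X ^~ w))) /\
  avg M @[M --> \oo] --> \int[P]_(w in D) psi (GX (X ^~ w)).
Proof.
have sgn M := Rintegral_signs iidX mD DO D0 (M := M)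
  (V := fun w => psi (toC01 (GX_partial (X ^~ w) M))) (G := fun f => psi (GX_sign f))
  (fun w f _ Xf => congr1 (fun h => psi (toC01 h)) (GX_partial_sign Xf)).
have [||mf cf] := bounded_cvg_Rintegral P mD (fun M => (sgn M).1) (f := fun w => psi (GX (X ^~ w))) (B := B).
- by move=> M w _; exact: psiB.
- move=> w Dw; apply/cvgn_eps => eps e0.
  have [M0 H] := DGX Dw (divr_gt0 e0 L0); exists M0 => M MM.
  rewrite distrC; apply: le_trans (psiL (b := eps / L) _) _; last by rewrite mulrC divfK // gt_eqF.
  move=> t; have -> := cabs_sub_toC01 (GX (X ^~ w)) (@continuous_GX_partial R (X ^~ w) M) t.
  exact: H.
split => //; have -> // : avg = fun M => \int[P]_(w in D) psi (toC01 (GX_partial (X ^~ w) M)).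
by apply/funext => M; rewrite (sgn M).2.
Qed.

Lemma lipschitz_fekete eps : 0 < eps -> exists p0, forall p, prime p -> (p0 <= p)%N ->
  `|p%:R^-1 * \sum_(k < p) psi (Gp R p k) - \int[P]_(w in D) psi (GX (X ^~ w))| <= eps.
Proof.
move=> e0; have e3 : 0 < eps / 3 by rewrite divr_gt0.
have [_ /cvgn_eps/(_ _ e3)[M1 H1]] := lipschitz_limit.
have [M2 _ H2] := @Gp_truncation R (eps / 3 / L) (divr_gt0 e3 L0).
(* One M serves both the truncation and the random series; only then is p taken large for the
   equidistribution of patterns. *)
have [M {}H1 [p1 {}H2]] : exists2 M, `|avg M - \int[P]_(w in D) psi (GX (X ^~ w))| <= eps / 3 &
    exists p1, forall p, prime p -> (p1 <= p)%N -> exists2 r : nat -> R,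
      (forall k t, cabs (Gp_fun p k t - GX_partial (fun m => - chi_shift R p k m) M t) <= r k)
      & \sum_(k < p) r k <= p%:R * (eps / 3 / L).
  exists (maxn M1 M2); first exact: H1 _ (leq_maxl _ _).
  exact: H2 _ (leq_maxr _ _).
have [p2 H3] := @sign_averageN R M (fun f => psi (GX_sign f)) B (eps / 3) e3 (fun f => psiB _).
exists (maxn p1 p2) => p p_pr; rewrite geq_max => /andP[pp1 pp2].
have p0 : 0 < p%:R :> R by rewrite ltr0n prime_gt0.
pose V k := psi (toC01 (GX_partial (fun m => - chi_shift R p k m) M)).
have {}H3 : `|\sum_(k < p) V k - p%:R * avg M| <= p%:R * (eps / 3).
  apply: (H3 p p_pr pp2 V) => [k|k f kf]; first exact: psiB.
  by rewrite /V /GX_sign (GX_partial_sign kf).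
have [r Hr Sr] := H2 p p_pr pp1.
have H4 : `|\sum_(k < p) psi (Gp R p k) - \sum_(k < p) V k| <= p%:R * (eps / 3).
  rewrite -sumrB; apply: le_trans (ler_norm_sum _ _ _) _.
  apply: (@le_trans _ _ (\sum_(k < p) L * r k)).
    apply: ler_sum => k _; apply: psiL => t.
    have -> := cabs_sub_toC01 (Gp R p k)
      (@continuous_GX_partial R (fun m => - chi_shift R p k m) M) t.
    exact: Hr.
  rewrite -mulr_sumr; apply: le_trans (ler_wpM2l (ltW L0) Sr) _.
  by rewrite mulrCA ler_pM2l // mulrC divfK // gt_eqF.
set I := \int[P]_(w in D) _ in H1 *.
set S := \sum_(k < p) _ in H4 *; set S' := \sum_(k < p) _ in H3 H4.
have -> : p%:R^-1 * S - I = p%:R^-1 * (S - S') + p%:R^-1 * (S' - p%:R * avg M) + (avg M - I).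
  by field; rewrite gt_eqF.
apply: le_trans (ler_normD _ _) _; apply: le_trans (lerD (ler_normD _ _) (lexx _)) _.
rewrite !normrM normfV normr_nat.
have hp (x : R) : `|x| <= p%:R * (eps / 3) -> p%:R^-1 * `|x| <= eps / 3.
  by move=> h; rewrite mulrC ler_pdivrMr // mulrC.
by have := hp (S' - p%:R * avg M) H3; have := hp (S - S') H4; lra.
Qed.

End Lipschitz.

Section BoundedContinuous.
Variables (phi : C01 R -> R) (B : R).
Hypotheses (cphi : continuous_sup phi) (phiB : forall f, `|phi f| <= B).

Let int psi := \int[P]_(w in D) psi (GX (X ^~ w)).

(** The index starts at 1 because [lipschitz_limit] asks for a positive Lipschitz constant. *)
Lemma lipreg_limit :
  measurable_fun D (fun w => phi (GX (X ^~ w))) /\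
  int (lipreg phi n.+1) @[n --> \oo] --> int phi.
Proof.
apply: (bounded_cvg_Rintegral P mD (u := fun n w => lipreg phi n.+1 (GX (X ^~ w))) (B := B)).
- move=> n; have n0 : 0 < n.+1%:R :> R by rewrite ltr0n.
  by have [] := lipschitz_limit n0 (lipreg_lipschitz phiB n.+1) (lipreg_bounded phiB n.+1).
- by move=> n w _; exact: lipreg_bounded.
- by move=> w _; have := lipreg_cvg phiB (f := GX (X ^~ w)) cphi; rewrite -cvg_shiftS.
Qed.

Lemma fekete_liminf eps : 0 < eps -> exists p0, forall p, prime p -> (p0 <= p)%N ->
  int phi - eps <= p%:R^-1 * \sum_(k < p) phi (Gp R p k).
Proof.
move=> e0; have e2 : 0 < eps / 2 by rewrite divr_gt0.
have [_ /cvgn_eps/(_ _ e2)[n Hn]] := lipreg_limit.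
have {Hn}Hn := Hn n (leqnn n).
have n0 : 0 < n.+1%:R :> R by rewrite ltr0n.
have [p0 H] := lipschitz_fekete n0 (lipreg_lipschitz phiB n.+1) (lipreg_bounded phiB n.+1) e2.
exists p0 => p p_pr pp; have {}H := H p p_pr pp.
have h : p%:R^-1 * \sum_(k < p) lipreg phi n.+1 (Gp R p k) <= p%:R^-1 * \sum_(k < p) phi (Gp R p k).
  by rewrite ler_wpM2l ?invr_ge0 //; apply: ler_sum => k _; exact: lipreg_le_fun phiB _ _.
move: Hn H; rewrite !ler_norml -/(int _) => /andP[h1 _] /andP[h2 _]; lra.
Qed.

End BoundedContinuous.

Lemma fekete_limit (phi : C01 R -> R) (B : R) :
  continuous_sup phi -> (forall f, `|phi f| <= B) ->
  forall eps, 0 < eps -> exists p0, forall p, prime p -> (p0 <= p)%N ->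
  `|p%:R^-1 * \sum_(k < p) phi (Gp R p k) - fine 'E_P[fun w => phi (GX (X ^~ w))]| <= eps.
Proof.
move=> cphi phiB eps e0.
have [mphi _] := lipreg_limit cphi phiB.
have cN : continuous_sup (fun f => - phi f).
  move=> f ep ep0; have [dl dl0 H] := cphi f ep ep0; exists dl => // g fg.
  by rewrite -opprD normrN; exact: H.
have NB f : `|- phi f| <= B by rewrite normrN.
have [p1 H1] := fekete_liminf cphi phiB e0.
have [p2 H2] := fekete_liminf cN NB e0.
(* Off [D] the value of [GX] may be the default one; that set is null and phi is bounded, so the
   integral is unchanged. *)
have -> : fine 'E_P[fun w => phi (GX (X ^~ w))] = \int[P]_(w in D) phi (GX (X ^~ w)).
  by rewrite unlock (integral_null_set (B := B) mD D0).
have iN : \int[P]_(w in D) (- phi (GX (X ^~ w))) = - \int[P]_(w in D) phi (GX (X ^~ w)).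
  under eq_Rintegral do rewrite -mulN1r.
  rewrite RintegralZl ?mulN1r //; apply: (bounded_integrable P (B := B)) => //.
exists (maxn p1 p2) => p p_pr; rewrite geq_max => /andP[pp1 pp2].
have := H1 p p_pr pp1; have := H2 p p_pr pp2; rewrite iN sumrN mulrN.
by move=> h1 h2; rewrite ler_norml; apply/andP; split; lra.
Qed.

End Convergence.

Theorem theorem2p1 (R : realType) (d : measure_display) (T : measurableType d)
    (P : probability T R) (X : int -> {RV P >-> R}) (iidX : iid_signs P X)
    (phi : C01 R -> R[i]) (cphi : continuous phi)
    (bphi : exists M : R, forall f : C01 R, cabs (phi f) <= M) :
  p%:R^-1 * \sum_(k < p) phi (Gp R p k)
    @[p --> within [set p : nat | prime p] \oo] -->
  expectationC P (fun w => phi (GX (fun m => X m w))).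
Proof.
have [D [mD DO D0 DGX]] := GX_ae iidX; have [B phiB] := bphi.
(* Applied to the real and the imaginary part of phi, matching the definition of [expectationC]. *)
have part (h : R[i] -> R) : (forall z w, h (z - w) = h z - h w) -> (forall z, `|h z| <= cabs z) ->
    forall eps, 0 < eps -> exists p0, forall p, prime p -> (p0 <= p)%N ->
    `|p%:R^-1 * \sum_(k < p) h (phi (Gp R p k)) - fine 'E_P[fun w => h (phi (GX (X ^~ w)))]| <= eps.
  move=> hB hle; apply: (@fekete_limit _ _ _ P X iidX D mD DO D0 DGX (fun f => h (phi f)) B); last first.
    by move=> f; exact: le_trans (hle _) (phiB f).
  move=> f eps e0.
  have nb : nbhs (phi f) [set z | cabs (phi f - z) < eps].
    by apply/nbhs_complexP; exists eps.
  have /nbhs_C01P[dl dl0 H] := cphi f _ nb; exists dl => // g fg.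
  by rewrite -hB; apply: le_trans (hle _) _; apply/ltW; exact: H.
move=> A /nbhs_complexP[eps e0 HA]; have e4 : 0 < eps / 4 by rewrite divr_gt0.
have [p1 H1] := part (@complex.Re R) (fun z w => raddfB _ z w) (@Re_le_cabs R) _ e4.
have [p2 H2] := part (@complex.Im R) (fun z w => raddfB _ z w) (@Im_le_cabs R) _ e4.
exists (maxn p1 p2) => // p /=; rewrite geq_max => /andP[pp1 pp2] p_pr.
apply: HA; rewrite cabs_distC; apply: le_lt_trans (cabs_le_ReIm _) _.
(* The scalar 1/p is an embedded real, so it commutes with real and imaginary parts. *)
have scal (z : R[i]) : p%:R^-1 * z = (p%:R^-1 : R)%:C * z by rewrite complex_natr fmorphV.
have reE (z : R[i]) (x : R) : complex.Re (x%:C * z) = x * complex.Re z by case: z => a b /=; ring.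
have imE (z : R[i]) (x : R) : complex.Im (x%:C * z) = x * complex.Im z by case: z => a b /=; ring.
have := H1 p p_pr pp1; have := H2 p p_pr pp2.
rewrite scal (raddfB (@complex.Re R)) (raddfB (@complex.Im R)) /= reE imE.
rewrite (raddf_sum (@complex.Re R)) (raddf_sum (@complex.Im R)) /=.
move=> h1 h2; lra.
Qed.
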